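(* Let $S$ be an $n$-dimensional Clifford quantum polynomial algebra. If $g_1,\dots,g_r\in Z(S)_2$ are linearly independent elements, then they form a regular sequence, so that $S/(g_1,\dots,g_r)$ is a Clifford quadratic complete intersection of length $r$ in $n$ variables. In particular, if $g_1,\dots,g_n\in Z(S)_2$ are linearly independent elements, then $S/(g_1,\dots,g_n)$ is the exterior algebra (on $n$ generators of degree $1$).
   Context: $k$ is an algebraically closed field of characteristic $0$; all algebras are over $k$. For graded right modules $M,N$ over a connected graded algebra $S$, $\underline{\mathrm{Ext}}^i_S(M,N)=\bigoplus_{j\in\mathbb Z}\mathrm{Ext}^i_{\mathrm{grmod}\,S}(M,N(j))$; $H_S(t)=\sum_i(\dim_k S_i)t^i$; $Z(S)$ is the center of $S$ and $Z(S)_2$ its degree-$2$ part. A noetherian connected graded algebra $S$ is an $n$-dimensional quantum polynomial algebra if $\mathrm{gldim}\,S=n$, $\underline{\mathrm{Ext}}^i_S(k,S)\cong k(n)$ for $i=n$ and $0$ for $i\neq n$, and $H_S(t)=(1-t)^{-n}$. For a sequence $F=(F_1,\dots,F_n)$ of linearly independent symmetric matrices in $M_n(k)$, the graded Clifford algebra is $$C(F)=k\langle x_1,\dots,x_n,y_1,\dots,y_n\rangle/\Big(x_ix_j+x_jx_i-\sum_{m=1}^n(F_m)_{ij}y_m,\; x_iy_j-y_jx_i,\; y_iy_j-y_jy_i\Big)_{1\le i,j\le n},$$ with $\deg x_i=1$, $\deg y_j=2$. An $n$-dimensional Clifford quantum polynomial algebra is an $n$-dimensional quantum polynomial algebra isomorphic,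 as a graded algebra, to some $C(F)$. A sequence $g_1,\dots,g_r\in Z(S)_2$ is regular if each $g_i$ is a non-zero-divisor in $S/(g_1,\dots,g_{i-1})$. A Clifford quadratic complete intersection of length $r$ in $n$ variables is an algebra $S/(g_1,\dots,g_r)$ with $S$ an $n$-dimensional Clifford quantum polynomial algebra and $g_1,\dots,g_r\in Z(S)_2$ a regular sequence. *)

(* Defs.v *)
From HB Require Import structures.
From mathcomp Require Import all_boot all_order all_algebra.
From mathcomp Require Import generic_quotient.
From mathcomp Require Import boolp classical_sets.
From mathcomp.multinomials Require Import monalg.

Set Implicit Arguments.
Unset Strict Implicit.
Unset Printing Implicit Defensive.

Import GRing.Theory.

Local Open Scope classical_set_scope.
Local Open Scope ring_scope.
Local Open Scope quotient_scope.

Definition two_sided_ideal (A : pzRingType) (J : set A) : Prop :=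
  [/\ J 0, forall a b, J a -> J b -> J (a + b),
      forall a b, J b -> J (a * b) & forall a b, J a -> J (a * b)].

Definition ideal_gen (A : pzRingType) (X : set A) : set A :=
  smallest (@two_sided_ideal A) X.

Lemma ideal_genP (A : pzRingType) (X : set A) : two_sided_ideal (ideal_gen X).
Proof.
split=> [J [[]]//|a b Ja Jb J JX|a b Jb J JX|a b Ja J JX].
- by case: (JX) => -[_ + _ _] _; apply; [exact: Ja|exact: Jb].
- by case: (JX) => -[_ _ + _] _; apply; exact: Jb.
- by case: (JX) => -[_ _ _ +] _; apply; exact: Ja.
Qed.

Lemma sub_ideal_gen (A : pzRingType) (X : set A) : X `<=` ideal_gen X.
Proof. exact: sub_gen_smallest. Qed.

(* Two-sided ideals not containing 1: in the library an [algType] is a nonzero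
   ring. *)
Record proper_ideal (A : pzRingType) := ProperIdeal {
  ideal_set :> set A;
  _ : two_sided_ideal ideal_set;
  _ : ~ ideal_set 1
}.

Lemma proper_ideal_gen (A : pzRingType) (X J : set A) :
  two_sided_ideal J -> ~ J 1 -> X `<=` J -> ~ ideal_gen X 1.
Proof. by move=> idJ J1 XJ; apply: contra_not J1; apply; split. Qed.

Section Quotient.
Context (k : comNzRingType) (A : algType k) (I : proper_ideal A).

Let J : set A := I.

Let idJ : two_sided_ideal J. Proof. by rewrite /J; case: I. Qed.
Let J0 : J 0. Proof. by case: idJ. Qed.
Let JD a b : J a -> J b -> J (a + b). Proof. by case: idJ => _ + _ _; apply. Qed.
Let JMl a b : J b -> J (a * b). Proof. by case: idJ => _ _ + _; apply. Qed.
Let JMr a b : J a -> J (a * b). Proof. by case: idJ => _ _ _ +; apply. Qed.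
Let JN a : J a -> J (- a). Proof. by move=> Ja; rewrite -mulN1r; exact: JMl. Qed.
Let JZ (c : k) a : J a -> J (c *: a).
Proof. by move=> Ja; rewrite -[a]mul1r scalerAl; exact: JMl. Qed.

Definition quot_rel (a b : A) : bool := `[< J (a - b) >].

Lemma quot_rel_equiv : equiv_class_of quot_rel.
Proof.
split=> [a|a b|b a c].
- by apply/asboolP; rewrite subrr; exact: J0.
- by apply/asboolP/asboolP => /JN; rewrite opprB.
- by move=> /asboolP ab /asboolP bc; apply/asboolP;
    rewrite -(subrKA b); exact: JD.
Qed.

Canonical quot_equiv := EquivRelPack quot_rel_equiv.

Definition quot := {eq_quot quot_equiv}.

HB.instance Definition _ := Choice.on quot.
HB.instance Definition _ := Quotient.on quot.

Definition quot_pi (a : A) : quot := \pi_quot a.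

Lemma quot_eqP a b : reflect (quot_pi a = quot_pi b) `[< J (a - b) >].
Proof. exact: (@eqquotP _ quot_equiv quot a b). Qed.

Lemma quot_eq a b : J (a - b) -> quot_pi a = quot_pi b.
Proof. by move=> h; apply/quot_eqP/asboolP. Qed.

Lemma quot_repr a : J (repr (quot_pi a) - a).
Proof. by apply/asboolP/quot_eqP; rewrite /quot_pi reprK. Qed.

Definition quot_add (p q : quot) : quot := quot_pi (repr p + repr q).
Definition quot_opp (p : quot) : quot := quot_pi (- repr p).
Definition quot_mul (p q : quot) : quot := quot_pi (repr p * repr q).
Definition quot_scale (c : k) (p : quot) : quot := quot_pi (c *: repr p).

Lemma quot_addE a b : quot_add (quot_pi a) (quot_pi b) = quot_pi (a + b).
Proof.
by apply: quot_eq; rewrite opprD addrACA; apply: JD; exact: quot_repr.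
Qed.

Lemma quot_oppE a : quot_opp (quot_pi a) = quot_pi (- a).
Proof. by apply: quot_eq; rewrite -opprD; apply/JN/quot_repr. Qed.

Lemma quot_mulE a b : quot_mul (quot_pi a) (quot_pi b) = quot_pi (a * b).
Proof.
apply: quot_eq; set a' := repr _; set b' := repr _.
rewrite -(subrKA (a' * b)) -mulrBr -mulrBl.
by apply: JD; [apply: JMl|apply: JMr]; exact: quot_repr.
Qed.

Lemma quot_scaleE c a : quot_scale c (quot_pi a) = quot_pi (c *: a).
Proof. by apply: quot_eq; rewrite -scalerBr; apply/JZ/quot_repr. Qed.

Lemma quot_ind (P : quot -> Prop) : (forall a, P (quot_pi a)) -> forall q, P q.
Proof. by move=> h q; rewrite -[q]reprK; apply: h. Qed.

Fact quot_addA : associative quot_add.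
Proof.
elim/quot_ind=> a; elim/quot_ind=> b; elim/quot_ind=> c.
by rewrite !quot_addE addrA.
Qed.
Fact quot_addC : commutative quot_add.
Proof. by elim/quot_ind=> a; elim/quot_ind=> b; rewrite !quot_addE addrC. Qed.
Fact quot_add0 : left_id (quot_pi 0) quot_add.
Proof. by elim/quot_ind=> a; rewrite quot_addE add0r. Qed.
Fact quot_addN : left_inverse (quot_pi 0) quot_opp quot_add.
Proof. by elim/quot_ind=> a; rewrite quot_oppE quot_addE addNr. Qed.

HB.instance Definition _ :=
  GRing.isZmodule.Build quot quot_addA quot_addC quot_add0 quot_addN.

Lemma quot_piD a b : quot_pi a + quot_pi b = quot_pi (a + b).
Proof. exact: quot_addE. Qed.

Fact quot_mulA : associative quot_mul.
Proof.
elim/quot_ind=> a; elim/quot_ind=> b; elim/quot_ind=> c.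
by rewrite !quot_mulE mulrA.
Qed.
Fact quot_mul1l : left_id (quot_pi 1) quot_mul.
Proof. by elim/quot_ind=> a; rewrite quot_mulE mul1r. Qed.
Fact quot_mul1r : right_id (quot_pi 1) quot_mul.
Proof. by elim/quot_ind=> a; rewrite quot_mulE mulr1. Qed.
Fact quot_mulDl : left_distributive quot_mul +%R.
Proof.
elim/quot_ind=> a; elim/quot_ind=> b; elim/quot_ind=> c.
by rewrite (quot_piD a b) !quot_mulE quot_piD mulrDl.
Qed.
Fact quot_mulDr : right_distributive quot_mul +%R.
Proof.
elim/quot_ind=> a; elim/quot_ind=> b; elim/quot_ind=> c.
by rewrite (quot_piD b c) !quot_mulE quot_piD mulrDr.
Qed.

Fact quot_oner_neq0 : quot_pi 1 != 0 :> quot.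
Proof.
apply/eqP => /quot_eqP/asboolP; rewrite subr0.
by rewrite /J; case: I.
Qed.

HB.instance Definition _ := GRing.Zmodule_isNzRing.Build quot
  quot_mulA quot_mul1l quot_mul1r quot_mulDl quot_mulDr quot_oner_neq0.

Fact quot_scaleA a b (p : quot) :
  quot_scale a (quot_scale b p) = quot_scale (a * b) p.
Proof. by elim/quot_ind: p => p; rewrite !quot_scaleE scalerA. Qed.
Fact quot_scale1 : left_id 1 quot_scale.
Proof. by elim/quot_ind=> a; rewrite quot_scaleE scale1r. Qed.
Fact quot_scaleDr : right_distributive quot_scale +%R.
Proof.
move=> c; elim/quot_ind=> a; elim/quot_ind=> b.
by rewrite (quot_piD a b) !quot_scaleE quot_piD scalerDr.
Qed.
Fact quot_scaleDl (p : quot) : {morph quot_scale^~ p : a b / a + b}.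
Proof.
move=> a b; elim/quot_ind: p => p.
by rewrite !quot_scaleE quot_piD scalerDl.
Qed.

HB.instance Definition _ := GRing.Zmodule_isLmodule.Build k quot
  quot_scaleA quot_scale1 quot_scaleDr quot_scaleDl.

Fact quot_scalerAl (c : k) (p q : quot) : c *: (p * q) = (c *: p) * q.
Proof.
elim/quot_ind: p => a; elim/quot_ind: q => b.
rewrite /GRing.scale /GRing.mul /= quot_mulE !quot_scaleE quot_mulE.
by rewrite scalerAl.
Qed.
Fact quot_scalerAr (c : k) (p q : quot) : c *: (p * q) = p * (c *: q).
Proof.
elim/quot_ind: p => a; elim/quot_ind: q => b.
rewrite /GRing.scale /GRing.mul /= quot_mulE !quot_scaleE quot_mulE.
by rewrite scalerAr.
Qed.

HB.instance Definition _ := GRing.Lmodule_isLalgebra.Build k quot quot_scalerAl.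
HB.instance Definition _ := GRing.Lalgebra_isAlgebra.Build k quot quot_scalerAr.

Fact quot_pi_linear : linear quot_pi.
Proof. by move=> c a b; rewrite -quot_piD -quot_scaleE. Qed.
Fact quot_pi_monoid : monoid_morphism quot_pi.
Proof. by split=> // a b; rewrite -quot_mulE. Qed.

HB.instance Definition _ :=
  GRing.isLinear.Build k A quot *:%R quot_pi quot_pi_linear.
HB.instance Definition _ :=
  GRing.isMonoidMorphism.Build A quot quot_pi quot_pi_monoid.

Definition quot_gr (gr : nat -> set A) (i : nat) : set quot :=
  quot_pi @` gr i.

End Quotient.

Record direct_sum (I : eqType) (V : zmodType) (gr : I -> set V) : Prop :=
  DirectSum {
    ds_zero : forall i, gr i 0;
    ds_sub : forall i x y, gr i x -> gr i y -> gr i (x - y);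
    ds_decomp : forall x, exists (s : seq I) (u : I -> V),
      [/\ uniq s, forall i, gr i (u i) & x = \sum_(i <- s) u i];
    ds_indep : forall (s : seq I) (u : I -> V),
      uniq s -> (forall i, gr i (u i)) -> \sum_(i <- s) u i = 0 ->
      forall i, i \in s -> u i = 0
  }.

(* The homogeneous parts are only required to be additive subgroups in
   [direct_sum]; they are k-subspaces because cg_gr 0 = k. *)
Record cgAlg (k : fieldType) := CgAlg {
  cg_alg :> algType k;
  cg_gr : nat -> set cg_alg;
  cg_ds : direct_sum cg_gr;
  cg_one : cg_gr 0%N 1;
  cg_mul : forall i j a b, cg_gr i a -> cg_gr j b -> cg_gr (i + j)%N (a * b);
  cg_conn : cg_gr 0%N = range (in_alg cg_alg)
}.

Section DirectSumTheory.
Context (I : eqType) (V : zmodType) (gr : I -> set V).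
Hypothesis ds : direct_sum gr.

Lemma ds_opp i x : gr i x -> gr i (- x).
Proof. by rewrite -sub0r; apply: (ds_sub ds); exact: (ds_zero ds). Qed.

Lemma ds_add i x y : gr i x -> gr i y -> gr i (x + y).
Proof. by move=> hx /ds_opp; rewrite -{2}[y]opprK; exact: (ds_sub ds). Qed.

Lemma ds_sum i (J : Type) (s : seq J) (P : pred J) (u : J -> V) :
  (forall j, P j -> gr i (u j)) -> gr i (\sum_(j <- s | P j) u j).
Proof.
move=> h; elim/big_ind: _ => //; [exact: (ds_zero ds)|exact: ds_add].
Qed.

End DirectSumTheory.

Section Augmentation.
Context (k : fieldType) (S : cgAlg k).

Let ds := cg_ds S.

(* S_{>= 1}, generated as an ideal by the homogeneous elements of positive
   degree. *)
Definition irrelevant : set S :=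
  ideal_gen [set a | exists2 i, (0 < i)%N & cg_gr i a].

Let psum (a : S) := exists l : seq (nat * S),
  (forall p, p \in l -> (0 < p.1)%N /\ cg_gr p.1 p.2) /\ a = \sum_(p <- l) p.2.

Let psum0 : psum 0. Proof. by exists [::]; rewrite big_nil. Qed.

Let psumD a b : psum a -> psum b -> psum (a + b).
Proof.
move=> [l [hl ->]] [m [hm ->]]; exists (l ++ m); split; last by rewrite big_cat.
by move=> p; rewrite mem_cat => /orP[/hl|/hm].
Qed.

Let psum_sum (J : Type) (s : seq J) (u : J -> S) :
  (forall j, psum (u j)) -> psum (\sum_(j <- s) u j).
Proof. by move=> h; elim/big_ind: _. Qed.

Let psum_ideal : two_sided_ideal psum.
Proof.
split=> //.
- move=> a b [l [hl ->]].
  have [s [u [_ hu ->]]] := ds_decomp ds a.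
  rewrite mulr_suml; apply: psum_sum => i.
  exists [seq ((i + p.1)%N, u i * p.2) | p <- l].
  rewrite big_map mulr_sumr; split=> // q /mapP[p /hl[p1 hp] ->]; split=> /=.
    by rewrite addn_gt0 p1 orbT.
  exact: cg_mul.
- move=> b a [l [hl ->]].
  have [s [u [_ hu ->]]] := ds_decomp ds a.
  rewrite mulr_sumr; apply: psum_sum => i.
  exists [seq ((p.1 + i)%N, p.2 * u i) | p <- l].
  rewrite big_map mulr_suml; split=> // q /mapP[p /hl[p1 hp] ->]; split=> /=.
    by rewrite addn_gt0 p1.
  exact: cg_mul.
Qed.

Let psum1 : ~ psum 1.
Proof.
move=> [l [hl e]].
pose u i : S := if i == 0%N then -1 else
  \sum_(p <- l | (p \in l) && (p.1 == i)) p.2.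
have hu i : cg_gr i (u i).
  rewrite /u; case: eqP => [->|_]; first exact/(ds_opp ds)/cg_one.
  by apply: (ds_sum ds) => p /andP[/hl[_ hp] /eqP <-].
pose t := undup (unzip1 l).
have t0 : 0%N \notin t.
  by rewrite mem_undup; apply/mapP => -[p /hl[+ _] p0]; rewrite -p0.
have : u 0%N = 0.
  apply: (ds_indep ds (s := 0%N :: t) (u := u)); rewrite ?mem_head //=.
    by rewrite t0 undup_uniq.
  rewrite big_cons {1}/u eqxx [X in -1 + X](_ : _ = 1) ?addNr//.
  rewrite e (@eq_big_seq _ _ _ _ t _ (fun i => \sum_(p <- l | p.1 == i) p.2)).
    rewrite (exchange_big_dep xpredT)//=; apply: eq_big_seq => p pl.
    rewrite -big_filter (_ : [seq i <- t | p.1 == i] = [:: p.1]) ?big_seq1//.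
    rewrite (eq_filter (a2 := pred1 p.1)) => [|i]; last exact: eq_sym.
    by rewrite filter_pred1_uniq ?undup_uniq// mem_undup map_f.
  move=> i it; rewrite /u; case: eqP => [i0|_]; first by rewrite -i0 it in t0.
  by rewrite big_seq_cond [RHS]big_seq_cond; apply: eq_bigl => p; rewrite andbA andbb.
by rewrite /u eqxx => /eqP; rewrite oppr_eq0 oner_eq0.
Qed.

Lemma irrelevant1 : ~ irrelevant 1.
Proof.
apply: (@proper_ideal_gen _ _ psum) => // a [i i0 hi].
by exists [:: (i, a)]; rewrite big_seq1; split=> // p; rewrite inE => /eqP ->.
Qed.

Definition irrelevant_ideal : proper_ideal S :=
  ProperIdeal (ideal_genP _) irrelevant1.

Lemma irrelevant_gen1 (X : set S) : X `<=` irrelevant -> ~ ideal_gen X 1.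
Proof. exact: proper_ideal_gen (ideal_genP _) irrelevant1. Qed.

Definition gen_ideal (X : set S) (hX : X `<=` irrelevant) : proper_ideal S :=
  ProperIdeal (ideal_genP X) (irrelevant_gen1 hX).

End Augmentation.

(* A right [R]-module is an [lmodType] over the converse ring [R^c]. *)

Definition surjective (A B : Type) (f : A -> B) : Prop := forall y, exists x, f x = y.

Definition projective (R : pzRingType) (P : lmodType R) : Prop :=
  forall (M N : lmodType R) (p : {linear M -> N}) (f : {linear P -> N}),
    surjective p -> exists g : {linear P -> M}, p \o g =1 f.

Definition exact_at (R : pzRingType) (L M N : lmodType R)
    (f : {linear L -> M}) (g : {linear M -> N}) : Prop :=
  forall x, g x = 0 <-> exists y, f y = x.

Definition is_resolution (R : pzRingType) (M : lmodType R)
    (P : nat -> lmodType R) (d : forall i, {linear P i.+1 -> P i})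
    (eps : {linear P 0%N -> M}) : Prop :=
  [/\ surjective eps, exact_at (d 0%N) eps & forall i, exact_at (d i.+1) (d i)].

Definition projdim_le (R : pzRingType) (M : lmodType R) (n : nat) : Prop :=
  exists (P : nat -> lmodType R) (d : forall i, {linear P i.+1 -> P i})
         (eps : {linear P 0%N -> M}),
    [/\ is_resolution d eps, forall i, projective (P i)
      & forall i, (n < i)%N -> forall x : P i, x = 0].

Definition gldim_le (R : pzRingType) (n : nat) : Prop :=
  forall M : lmodType R^c, projdim_le M n.

Definition has_gldim (R : pzRingType) (n : nat) : Prop :=
  gldim_le R n /\ forall m, gldim_le R m -> (n <= m)%N.

Definition fin_gen (R : pzRingType) (M : lmodType R) (N : set M) : Prop :=
  exists (m : nat) (b : 'I_m -> M), (forall i, N (b i)) /\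
    forall x, N x -> exists c : 'I_m -> R, x = \sum_i c i *: b i.

Definition submodule (R : pzRingType) (M : lmodType R) (N : set M) : Prop :=
  N 0 /\ forall (c : R) x y, N x -> N y -> N (c *: x + y).

Definition left_noetherian (R : pzRingType) : Prop :=
  forall J : set R^o, submodule J -> fin_gen J.

Definition noetherian (R : pzRingType) : Prop :=
  left_noetherian R /\ left_noetherian R^c.

Section GrMod.
Context (k : fieldType) (S : cgAlg k).

Record grmod := GrMod {
  gm_mod :> lmodType S^c;
  gm_gr : int -> set gm_mod;
  gm_ds : direct_sum gm_gr;
  gm_act : forall (i : int) (j : nat) (x : gm_mod) (a : S),
    gm_gr i x -> cg_gr j a -> gm_gr (i + j%:Z) ((a : S^c) *: x);
  gm_fg : fin_gen [set: gm_mod]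
}.

Definition grhom (M N : grmod) (f : M -> N) : Prop :=
  linear f /\ forall i x, gm_gr i x -> gm_gr i (f x).

Definition gr_projective (P : grmod) : Prop :=
  forall (M N : grmod) (p : M -> N) (f : P -> N),
    grhom p -> surjective p -> grhom f -> exists2 g : P -> M, grhom g & p \o g =1 f.

Lemma shift_ds (M : grmod) (m : int) : direct_sum (fun i => @gm_gr M (m + i)).
Proof.
case: (gm_ds M) => h0 hB hD hI; split=> [i|i|x|s u us hu su0 i is_].
- exact: h0.
- exact: hB.
- have [s [u [us hu ->]]] := hD x.
  exists [seq i - m | i <- s], (fun i => u (m + i)); split=> //.
  + by rewrite map_inj_uniq// => i j /addIr.
  + by rewrite big_map; apply: eq_bigr => i _; rewrite addrC subrK.
- rewrite -[i](addKr m) [- m + _]addrC.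
  apply: (hI [seq m + i | i <- s] (fun i => u (i - m))).
  + by rewrite map_inj_uniq// => ? ? /addrI.
  + by move=> j; have := hu (j - m); rewrite addrC subrK.
  + by rewrite big_map -[RHS]su0; apply: eq_bigr => j _; rewrite addrC addKr.
  + by rewrite map_f.
Qed.

(* M(m), with M(m)_i = M_(m + i) *)
Definition shift (M : grmod) (m : int) : grmod.
Proof.
refine (@GrMod M (fun i => @gm_gr M (m + i)) (shift_ds M m) _ (gm_fg M)).
by move=> i j x a hx ha; rewrite addrA; exact: gm_act.
Defined.

Definition zgr (V : zmodType) (gr : nat -> set V) (i : int) : set V :=
  if i is Posz m then gr m else [set 0].

Lemma zgr_ds (V : zmodType) (gr : nat -> set V) :
  direct_sum gr -> direct_sum (zgr gr).
Proof.
move=> [h0 hB hD hI]; split=> [[]//|[m|m] x y /=|x|s u us hu su0 i is_].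
- exact: hB.
- by move=> -> ->; rewrite subr0.
- have [s [u [us hu ->]]] := hD x.
  exists (map Posz s), (fun i => if i is Posz m then u m else 0); split=> [||].
  + by rewrite map_inj_uniq// => ? ? [].
  + by case=> /=.
  + by rewrite big_map.
- case: i is_ => [m|m] is_; last exact: (hu (Negz m)).
  pose t := pmap (fun i : int => if i is Posz m then Some m else None) s.
  apply: (hI t (fun m => u (Posz m))).
  + by apply: pmap_uniq us => -[].
  + by move=> j; exact: (hu (Posz j)).
  + rewrite -[RHS]su0 /t; elim: s {us su0 is_ t} => [|[j|j] s IH] /=.
    * by rewrite !big_nil.
    * by rewrite !big_cons IH.
    * by rewrite IH big_cons (hu (Negz j) : u _ = 0) add0r.
  + by rewrite mem_pmap; apply/mapP; exists (Posz m).
Qed.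

Definition regular_mod : grmod.
Proof.
refine (@GrMod (S^c)^o (zgr (@cg_gr k S)) (zgr_ds (cg_ds S)) _ _).
- move=> [i|i] j x a /= hx ha; first exact: cg_mul.
  rewrite hx scaler0.
  case: (Negz i + j%:Z) => // m; exact: (ds_zero (cg_ds S)).
- exists 1%N, (fun=> 1); split=> // x _; exists (fun=> x).
  by rewrite big_ord1 /GRing.scale /= mulr1.
Defined.

(* k = S/S_{>= 1} as a right S-module *)
Definition trivial_carrier := quot (irrelevant_ideal S).
HB.instance Definition _ := GRing.Zmodule.on trivial_carrier.

Definition trivial_scale (a : S^c) (q : trivial_carrier) : trivial_carrier :=
  (q : quot (irrelevant_ideal S)) * quot_pi (irrelevant_ideal S) a.

Fact trivial_scaleA a b q :
  trivial_scale a (trivial_scale b q) = trivial_scale (a * b) q.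
Proof. by rewrite /trivial_scale -mulrA -rmorphM. Qed.
Fact trivial_scale1 : left_id 1 trivial_scale.
Proof. by move=> q; rewrite /trivial_scale rmorph1 mulr1. Qed.
Fact trivial_scaleDr : right_distributive trivial_scale +%R.
Proof. by move=> a p q; rewrite /trivial_scale mulrDl. Qed.
Fact trivial_scaleDl q : {morph trivial_scale^~ q : a b / a + b}.
Proof. by move=> a b; rewrite /trivial_scale rmorphD mulrDr. Qed.

HB.instance Definition _ := GRing.Zmodule_isLmodule.Build S^c trivial_carrier
  trivial_scaleA trivial_scale1 trivial_scaleDr trivial_scaleDl.

Lemma trivial_pi0 i a : (0 < i)%N -> @cg_gr k S i a ->
  quot_pi (irrelevant_ideal S) a = 0.
Proof.
move=> i0 ha; rewrite -(rmorph0 (quot_pi (irrelevant_ideal S))).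
by apply: quot_eq; rewrite subr0; apply: sub_ideal_gen; exists i.
Qed.

Lemma trivial_ds :
  direct_sum (quot_gr (I := irrelevant_ideal S) (@cg_gr k S)).
Proof.
split=> [i|i _ _ [a ha <-] [b hb <-]|x|s u us hu su0 i is_].
- by exists 0; [exact: (ds_zero (cg_ds S))|exact: rmorph0].
- by exists (a - b); [exact: (ds_sub (cg_ds S))|exact: rmorphB].
- elim/quot_ind: x => x; have [s [u [us hu ->]]] := ds_decomp (cg_ds S) x.
  exists s, (fun i => quot_pi _ (u i)); split=> // [i|]; last exact: raddf_sum.
  by exists (u i).
- have u0 j : (0 < j)%N -> u j = 0.
    by move=> j0; have [a ha <-] := hu j; exact: trivial_pi0 ha.
  case: i is_ => [is_|i _]; last exact: u0.
  rewrite -su0 (bigD1_seq 0%N)//= big1 ?addr0// => j.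
  by rewrite -lt0n; exact: u0.
Qed.

Definition trivial_mod : grmod.
Proof.
refine (@GrMod trivial_carrier
  (zgr (quot_gr (I := irrelevant_ideal S) (@cg_gr k S))) (zgr_ds trivial_ds)
  _ _).
- move=> [i|i] j x a /= hx ha.
    case: hx => b hb <-; exists (b * a); first exact: cg_mul.
    exact: rmorphM.
  rewrite hx scaler0; case: (Negz i + j%:Z) => // m; exact: (ds_zero trivial_ds).
- exists 1%N, (fun=> 1 : quot (irrelevant_ideal S)); split=> // x _.
  exists (fun=> (repr (x : quot (irrelevant_ideal S)) : S)).
  rewrite big_ord1 /GRing.scale /= /trivial_scale mul1r.
  by rewrite /quot_pi reprK.
Defined.

Section Ext.
Context (M N : grmod) (P : nat -> grmod) (d : forall i, {linear P i.+1 -> P i}).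

Definition gr_resolution (eps : {linear P 0%N -> M}) : Prop :=
  [/\ is_resolution (P := fun i => gm_mod (P i)) d eps, grhom eps,
      forall i, grhom (d i) & forall i, gr_projective (P i)].

Definition cocycle (i : nat) (f : P i -> N) : Prop :=
  grhom f /\ forall x, f (d i x) = 0.

Definition coboundary (i : nat) : (P i -> N) -> Prop :=
  match i with
  | 0%N => fun f => forall x, f x = 0
  | j.+1 => fun f => exists2 h : P j -> N, grhom h & f =1 h \o d j
  end.

End Ext.

(* Ext^i_{grmod S}(M, N) is isomorphic, as a k-vector space, to the subspace W
   of V: the i-th cohomology of Hom(P, N), for a projective resolution P of M,
   is presented as cocycles modulo coboundaries. *)
Definition Ext_iso (i : nat) (M N V : grmod) (W : set V) : Prop :=
  exists (P : nat -> grmod) (d : forall j, {linear P j.+1 -> P j})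
         (eps : {linear P 0%N -> M}) (phi : (P i -> N) -> V),
    [/\ gr_resolution d eps,
        forall f g (c : k), cocycle d f -> cocycle d g ->
          phi (fun x => (c%:A : S^c) *: f x + g x)
          = (c%:A : S^c) *: phi f + phi g,
        phi @` [set f | cocycle d f] = W
      & forall f, cocycle d f -> phi f = 0 <-> coboundary d f].

End GrMod.

Definition lin_indep (k : pzRingType) (V : lmodType k) (m : nat)
    (v : 'I_m -> V) : Prop :=
  forall c : 'I_m -> k, \sum_i c i *: v i = 0 -> forall i, c i = 0.

Definition has_dim (k : pzRingType) (V : lmodType k) (W : set V) (m : nat) : Prop :=
  exists b : 'I_m -> V, [/\ forall i, W (b i), lin_indep b &
    forall x, W x -> exists c : 'I_m -> k, x = \sum_i c i *: b i].

(* H_S(t) (1 - t)^n = 1 as formal power series in t. *)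
Definition hilbert_inv_pow (k : fieldType) (S : cgAlg k) (n : nat) : Prop :=
  exists h : nat -> nat, (forall i, has_dim (@cg_gr k S i) (h i)) /\
    forall m, \sum_(i < m.+1) (h i)%:Z * ((1 - 'X) ^+ n : {poly int})`_(m - i)
              = (m == 0%N)%:Z.

(* The graded isomorphism of Ext^i(k, S), the sum over j of the
   Ext^i_{grmod S}(k, S(j)), with k(n) or 0 is stated degree by degree: the
   degree j part of k(n) is k for j = - n and 0 otherwise. *)
Definition quantum_polynomial (k : fieldType) (n : nat) (S : cgAlg k) : Prop :=
  [/\ noetherian S, has_gldim S n,
      forall (i : nat) (j : int),
        Ext_iso i (trivial_mod S) (shift (regular_mod S) j)
          (V := shift (trivial_mod S) n)
          (if i == n then gm_gr j else [set 0])
    & hilbert_inv_pow S n].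

Definition graded_iso (k : pzRingType) (A B : algType k)
    (grA : nat -> set A) (grB : nat -> set B) : Prop :=
  exists f : {lrmorphism A -> B}, bijective f /\ forall i, f @` grA i = grB i.

Section FreeAlgebra.
Context (k : fieldType) (I : choiceType).

Definition free_alg := {malg k[{fmonom I}]}.

HB.instance Definition _ := GRing.Lalgebra.on free_alg.

Fact free_scalerAr (c : k) (p q : free_alg) : c *: (p * q) = p * (c *: q).
Proof.
have malgCC (q' : {malg k[{fmonom I}]}) : q' * c%:MP = c *: q'.
  rewrite -mul_malgC !malgM_def fgmulUg fgmulgU.
  by apply: eq_bigr => u _; rewrite mul1m mulm1 mulrC.
rewrite -[c *: q]mul_malgC mulrA -[p in LHS]/(p : {malg k[{fmonom I}]}).
by rewrite malgCC scalerAl.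
Qed.

HB.instance Definition _ := GRing.Lalgebra_isAlgebra.Build k free_alg free_scalerAr.

Definition free_gen (i : I) : free_alg := << fmu i >>.

(* The constant coefficient, used to show that relations without constant term
   generate a proper ideal. *)
Definition free_aug (p : free_alg) : k := mcoeff (mone : {fmonom I}) p.

Lemma free_augM p q : free_aug (p * q) = free_aug p * free_aug q.
Proof.
exact: (rmorphM (mcoeff (mone : {fmonom I}) : {rmorphism {malg k[{fmonom I}]} -> k})).
Qed.
Lemma free_augD p q : free_aug (p + q) = free_aug p + free_aug q.
Proof. exact: mcoeffD. Qed.
Lemma free_augN p : free_aug (- p) = - free_aug p.
Proof. exact: mcoeffN. Qed.
Lemma free_augZ c p : free_aug (c *: p) = c * free_aug p.
Proof. exact: mcoeffZ. Qed.
Lemma free_aug0 : free_aug 0 = 0.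
Proof. exact: mcoeff0. Qed.
Lemma free_aug1 : free_aug 1 = 1.
Proof. by rewrite /free_aug [LHS]mcoeff1 eqxx. Qed.
Lemma free_aug_gen i : free_aug (free_gen i) = 0.
Proof.
rewrite /free_aug [LHS]mcoeffU1 (_ : _ == _ = false)//.
by apply/eqP => /(congr1 (@fdeg _)); rewrite fdegU fdeg1.
Qed.
Lemma free_aug_sum (J : finType) (u : J -> free_alg) :
  (forall j, free_aug (u j) = 0) -> free_aug (\sum_j u j) = 0.
Proof.
move=> h; elim/big_rec: _ => [|j p _ p0]; first exact: free_aug0.
by rewrite free_augD h p0 addr0.
Qed.

Lemma free_proper (X : set free_alg) :
  (forall p, X p -> free_aug p = 0) -> ~ ideal_gen X 1.
Proof.
apply: proper_ideal_gen => [|/=]; last first.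
  by rewrite free_aug1 => /eqP; rewrite oner_eq0.
split=> /= [|p q p0 q0|p q q0|p q p0]; first exact: free_aug0.
- by rewrite free_augD p0 q0 addr0.
- by rewrite free_augM q0 mulr0.
- by rewrite free_augM p0 mul0r.
Qed.

(* The grading in which the generator i has degree w i. *)
Definition free_gr (w : I -> nat) (m : nat) : set free_alg :=
  [set p | forall u : {fmonom I}, (p : {malg k[{fmonom I}]})@_u != 0 ->
    (\sum_(i <- (u : seq I)) w i)%N = m].

End FreeAlgebra.

Section Clifford.
Context (k : fieldType) (n : nat) (F : 'I_n -> 'M[k]_n).

(* inl i stands for x_i and inr i for y_i *)
Definition clifford_free := free_alg k ('I_n + 'I_n)%type.
Definition clifford_x (i : 'I_n) : clifford_free := free_gen k (inl i).
Definition clifford_y (i : 'I_n) : clifford_free := free_gen k (inr i).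
Local Notation x := clifford_x.
Local Notation y := clifford_y.

Definition clifford_rel : set clifford_free :=
  [set p | exists i j, [\/ p = x i * x j + x j * x i - \sum_m F m i j *: y m,
                          p = x i * y j - y j * x i
                        | p = y i * y j - y j * y i]].

Lemma clifford_proper : ~ ideal_gen clifford_rel 1.
Proof.
have x0 i : free_aug (x i) = 0 by exact: free_aug_gen.
have y0 i : free_aug (y i) = 0 by exact: free_aug_gen.
have M0 p q : free_aug p = 0 -> free_aug (p * q : clifford_free) = 0.
  by move=> p0; rewrite free_augM p0 mul0r.
have D0 p q : free_aug p = 0 -> free_aug q = 0 ->
    free_aug (p + q : clifford_free) = 0.
  by move=> p0 q0; rewrite free_augD p0 q0 addr0.
have B0 p q : free_aug p = 0 -> free_aug q = 0 ->
    free_aug (p - q : clifford_free) = 0.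
  by move=> p0 q0; rewrite free_augD free_augN p0 q0 subr0.
apply: free_proper => _ [i [j [] ->]]; apply: B0; try exact: M0.
- by apply: D0; exact: M0.
- by apply: free_aug_sum => m; rewrite free_augZ y0 mulr0.
Qed.

Definition clifford_ideal : proper_ideal clifford_free :=
  ProperIdeal (ideal_genP _) clifford_proper.

Definition clifford_alg : algType k := quot clifford_ideal.

Definition clifford_gr : nat -> set clifford_alg :=
  quot_gr (free_gr (fun u : 'I_n + 'I_n => if u is inl _ then 1%N else 2%N)).

End Clifford.

Arguments clifford_gr {k n} F _ _.

Definition clifford_quantum_polynomial (k : fieldType) (n : nat) (S : cgAlg k) : Prop :=
  quantum_polynomial n S /\
  exists F : 'I_n -> 'M[k]_n,
    [/\ forall m, (F m)^T = F m, free [seq F m | m : 'I_n]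
      & graded_iso (@cg_gr k S) (clifford_gr F)].

Section Exterior.
Context (k : fieldType) (n : nat).

Definition exterior_rel : set (free_alg k 'I_n) :=
  [set v * v | v in range (fun c : 'I_n -> k => \sum_i c i *: free_gen k i)].

Lemma exterior_proper : ~ ideal_gen exterior_rel 1.
Proof.
apply: free_proper => _ [_ [c _ <-] <-].
rewrite free_augM [X in X * _](_ : _ = 0) ?mul0r//; apply: free_aug_sum => i.
by rewrite free_augZ free_aug_gen mulr0.
Qed.

Definition exterior_ideal : proper_ideal (free_alg k 'I_n) :=
  ProperIdeal (ideal_genP _) exterior_proper.

Definition exterior_alg : algType k := quot exterior_ideal.

Definition exterior_gr : nat -> set exterior_alg := quot_gr (free_gr (fun=> 1%N)).

End Exterior.

Arguments exterior_gr k n _ _ : clear implicits.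

Definition center (A : pzRingType) : set A := [set z | forall a, GRing.comm z a].

Section CentralSequence.
Context (k : fieldType) (S : cgAlg k) (r : nat).

Definition in_Z2 (g : 'I_r -> S) : Prop :=
  forall i, (@center S `&` @cg_gr k S 2) (g i).

Variable g : 'I_r -> S.
Hypothesis hg : in_Z2 g.

Lemma in_Z2_irrelevant (m : nat) :
  [set g j | j in [set j : 'I_r | (j < m)%N]] `<=` @irrelevant k S.
Proof.
move=> _ [j _ <-]; apply: sub_ideal_gen; exists 2%N => //.
by have [] := hg j.
Qed.

Definition seq_ideal (m : nat) : proper_ideal S := gen_ideal (@in_Z2_irrelevant m).

Definition seq_quot (m : nat) : algType k := quot (seq_ideal m).

Definition seq_quot_gr (m : nat) : nat -> set (seq_quot m) := quot_gr (@cg_gr k S).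

Definition regular_sequence : Prop :=
  forall i : 'I_r, let gi : seq_quot i := quot_pi (seq_ideal i) (g i) in
    GRing.lreg gi /\ GRing.rreg gi.

End CentralSequence.

Arguments seq_quot_gr {k S r g} hg m _ _.

Definition clifford_qci (k : fieldType) (n r : nat) (A : algType k)
    (grA : nat -> set A) : Prop :=
  exists (S : cgAlg k) (g : 'I_r -> S) (hg : in_Z2 g),
    [/\ clifford_quantum_polynomial n S, regular_sequence hg
      & graded_iso (seq_quot_gr hg r) grA].

(* Main.v *)
(**
Let [x i], [y i] be the images in [S] of the generators of the graded Clifford
algebra and let [B i j = x i * x j + x j * x i], a combination of the [y m].

For every linear form [f] on the span of the [x i] there is a contraction
[delta], a [y]-linear skew derivation with [delta (x i) = f i]. If [v <> 0]
is killed by all the matrices [F m], then [X = \sum_i v i *: x i] has square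
zero, and a contraction with [delta X = 1] shows that its annihilator is [X S].
Then [X S] has an infinite periodic resolution, contradicting finite global
dimension. Hence no such [v] exists. Writing a central element of
degree 2 as [\sum_m a m *: y m + \sum_i \sum_j b i j *: (x i * x j)], centrality
gives [(b - b^T) F m = 0] for all [m], so [b] is symmetric: Z(S)_2 is the span
of the [y m].

Linearly independent [g 0], ..., [g (r - 1)] in Z(S)_2 therefore extend to a
basis [g] of the span of the [y m]. The elements
[\prod_i x i ^+ odd (e i) * \prod_i g i ^+ (e i)./2], indexed by exponents
[e : {ffun 'I_n -> nat}] and of degree [\sum_i e i], span [S]; in degree [d]
their number is the coefficient of t^d in (1 - t)^(-n), so they form a basis.
Thus [S] looks like the polynomial ring k[z_1, ..., z_n] on which [g i] acts as
z_i^2, and regularity becomes a statement about monomials. Finally, the quotient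
of the Clifford presentation by all the [y m] is the exterior algebra.
*)

Require Import Defs.
From mathcomp Require Import all_boot all_order all_algebra.
From HB Require Import structures.
From mathcomp Require Import boolp classical_sets.
From mathcomp Require Import finmap ring zify.
From mathcomp.multinomials Require Import monalg.

Set Implicit Arguments.
Unset Strict Implicit.
Unset Printing Implicit Defensive.

Import GRing.Theory.
Local Open Scope ring_scope.

(** * Free algebras *)

Section FreeEval.
Context (k : fieldType) (I : choiceType) (B : nzRingType).
Context (c : {rmorphism k -> B}) (h : I -> B).

Definition word_eval (u : {fmonom I}) : B := \prod_(i <- (u : seq I)) h i.

Lemma word_eval_mmorphism : mmorphism word_eval.
Proof.
split=> [u v|]; first by rewrite /word_eval fmM big_cat.
by rewrite /word_eval fm1 big_nil.
Qed.

HB.instance Definition _ :=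
  isMultiplicative.Build _ _ word_eval word_eval_mmorphism.

(** Scalars enter through a separate ring map [c], because the contraction on a Clifford algebra
    uses the target ['M[S]_2] with [S] noncommutative. *)
Definition free_eval (p : free_alg k I) : B := mmap c word_eval p.

Lemma free_eval_gen i : free_eval (free_gen k i) = h i.
Proof.
rewrite /free_eval [LHS]mmapU [X in X * _](rmorph1 c) mul1r.
by rewrite /word_eval fmU big_seq1.
Qed.

Lemma free_evalZ a p : free_eval (a *: p) = c a * free_eval p.
Proof. exact: mmapZ. Qed.

Lemma free_eval_zmod : zmod_morphism free_eval.
Proof. exact: mmap_is_additive. Qed.

Lemma free_eval_monoid :
  (forall a b, GRing.comm (c a) b) -> monoid_morphism free_eval.
Proof.
move=> cC; have := @commr_mmap_is_multiplicative _ _ _ c word_eval.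
by case=> [*|? ?]; [exact: cC|split].
Qed.

End FreeEval.

Lemma free_universal (k : fieldType) (I : choiceType) (B : algType k) (h : I -> B) :
  exists e : {lrmorphism free_alg k I -> B}, forall i, e (free_gen k i) = h i.
Proof.
pose e := free_eval (in_alg B) h.
have eZ : scalable e by move=> a p; rewrite /e free_evalZ /= mulr_algl.
have eM : monoid_morphism e.
  by apply: free_eval_monoid => a b; rewrite /GRing.comm /= mulr_algl mulr_algr.
pose e' : {lrmorphism free_alg k I -> B} := HB.pack e
  (GRing.isZmodMorphism.Build _ _ e (free_eval_zmod _ h))
  (GRing.isScalable.Build _ _ _ _ e eZ) (GRing.isMonoidMorphism.Build _ _ e eM).
by exists e' => i; exact: free_eval_gen.
Qed.

Section FreeAlgebraTheory.
Context (k : fieldType) (I : choiceType).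
Implicit Types (p q : free_alg k I).

Lemma free_word (s : seq I) :
  \prod_(i <- s) free_gen k i = << FMonom s >> :> free_alg k I.
Proof.
elim: s => [|i s IHs].
  by rewrite big_nil; congr << _ >>; apply/eqP; rewrite fmP fm1.
rewrite big_cons IHs [LHS]fgmulUU mulr1; congr << _ >>.
by apply/eqP; rewrite fmP fmM fmU.
Qed.

Lemma free_monalgE p :
  p = \sum_(u <- msupp p) p@_u *: \prod_(i <- (u : seq I)) free_gen k i.
Proof.
rewrite [LHS]monalgE; apply: eq_bigr => u _; rewrite free_word fmK.
by apply/malgP => v; rewrite mcoeffZ !mcoeffU mulrnAr mulr1.
Qed.

Lemma free_ind (P : free_alg k I -> Prop) :
  P 0 -> P 1 -> (forall a p q, P p -> P q -> P (a *: p + q)) ->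
  (forall i p, P p -> P (free_gen k i * p)) -> forall p, P p.
Proof.
move=> P0 P1 PD PM p.
rewrite [p]free_monalgE; elim: (enum_fset _) => [|u s IHs]; first by rewrite big_nil.
rewrite big_cons; apply: PD => //; elim: (u : seq I) => [|i t].
  by rewrite big_nil.
by rewrite big_cons; exact: PM.
Qed.

Lemma free_ext (B : nzRingType) (e e' : {rmorphism free_alg k I -> B}) :
  (forall a, e (in_alg _ a) = e' (in_alg _ a)) ->
  (forall i, e (free_gen k i) = e' (free_gen k i)) -> e =1 e'.
Proof.
move=> ec eg; elim/free_ind=> [||a p q ep eq|i p ep]; rewrite ?rmorph0 ?rmorph1//.
  by rewrite -mulr_algl !rmorphD !rmorphM /= ep eq ec.
by rewrite !rmorphM /= ep eg.
Qed.

Lemma free_gr_ind (w : I -> nat) d (P : free_alg k I -> Prop) :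
  P 0 -> (forall a p q, P p -> P q -> P (a *: p + q)) ->
  (forall s : seq I, (\sum_(i <- s) w i)%N = d ->
     P (\prod_(i <- s) free_gen k i)) ->
  forall p, free_gr w d p -> P p.
Proof.
move=> P0 PD PU p hp; rewrite [p]free_monalgE big_seq.
elim/big_rec: _ => // u q up; apply: PD; apply: PU; apply: hp.
by rewrite mcoeff_neq0.
Qed.

Lemma free_gr_prod (w : I -> nat) (s : seq I) :
  free_gr w (\sum_(i <- s) w i)%N (\prod_(i <- s) free_gen k i).
Proof.
rewrite free_word => u; rewrite mcoeffU.
by have [<-//|_] := FMonom s =P u; rewrite mulr0n eqxx.
Qed.

End FreeAlgebraTheory.

(** * Quotients and the Clifford presentation *)

Section Factorization.
Context (k : fieldType) (T A B : algType k).

Lemma lrmorphism_factor (p : {lrmorphism T -> A}) (q : {lrmorphism T -> B}) :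
  (forall a, exists t, p t = a) -> (forall t, p t = 0 -> q t = 0) ->
  exists r : {lrmorphism A -> B}, forall t, r (p t) = q t.
Proof.
move=> p_surj pq; have [s sK] := choice p_surj.
have rE t : q (s (p t)) = q t.
  apply/eqP; rewrite -subr_eq0 -[X in X == _](raddfB q); apply/eqP/pq.
  by rewrite raddfB /= sK subrr.
pose r a := q (s a).
have r_lin : linear r.
  move=> c a b; have e : c *: a + b = p (c *: s a + s b) by rewrite linearP /= !sK.
  by rewrite /r e rE linearP.
have r_mon : monoid_morphism r.
  split=> [|a b]; first by rewrite /r -(rmorph1 p) rE rmorph1.
  have e : a * b = p (s a * s b) by rewrite rmorphM /= !sK.
  by rewrite /r e rE rmorphM.
pose r' : {lrmorphism A -> B} := HB.pack r
  (GRing.isLinear.Build _ _ _ _ r r_lin) (GRing.isMonoidMorphism.Build _ _ r r_mon).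
by exists r' => t; exact: rE.
Qed.

End Factorization.

Lemma ideal_gen_min (A : pzRingType) (X J : set A) :
  two_sided_ideal J -> (X `<=` J)%classic -> (ideal_gen X `<=` J)%classic.
Proof. by move=> idJ XJ a; apply. Qed.

Lemma ker_ideal (A B : nzRingType) (e : {rmorphism A -> B}) :
  two_sided_ideal [set a | e a = 0]%classic.
Proof.
split=> /= [|a b ea eb|a b eb|a b ea]; rewrite ?rmorph0//.
- by rewrite rmorphD /= ea eb addr0.
- by rewrite rmorphM /= eb mulr0.
- by rewrite rmorphM /= ea mul0r.
Qed.

Lemma quot_pi_eq0 (k : comNzRingType) (A : algType k) (I : Defs.proper_ideal A) a :
  quot_pi I a = 0 <-> ideal_set I a.
Proof.
rewrite -(rmorph0 (quot_pi I)); split=> [/quot_eqP/asboolP|Ia].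
  by rewrite subr0.
by apply: quot_eq; rewrite subr0.
Qed.

Lemma quot_lrmorphism (k : comNzRingType) (A : algType k) (I : Defs.proper_ideal A) :
  exists p : {lrmorphism A -> quot I},
    [/\ p =1 quot_pi I, forall q, exists a, p a = q
      & forall a, p a = 0 <-> ideal_set I a].
Proof.
exists (quot_pi I : {lrmorphism A -> quot I}); split=> [//|q|a].
  by elim/quot_ind: q => a; exists a.
exact: quot_pi_eq0.
Qed.

Section Anticommutators.
Context (A B : pzRingType).

Lemma sqr0_anticomm (a b : A) :
  a * a = 0 -> b * b = 0 -> (a + b) * (a + b) = 0 -> a * b + b * a = 0.
Proof. by move=> aa bb; rewrite mulrDl !mulrDr aa bb addr0 add0r. Qed.

Lemma rmorph_anticomm (f : {rmorphism A -> B}) a b c :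
  f (a * b + b * a - c) = f a * f b + f b * f a - f c.
Proof. by rewrite rmorphB rmorphD !rmorphM. Qed.

Lemma rmorph_commutator (f : {rmorphism A -> B}) a b :
  f (a * b - b * a) = f a * f b - f b * f a.
Proof. by rewrite rmorphB !rmorphM. Qed.

End Anticommutators.

Definition clifford_wt n (u : 'I_n + 'I_n) : nat := if u is inl _ then 1 else 2.

(** The quotient map is composed with the inverse of the graded isomorphism; later arguments then
    use only the kernel of [phi] and its effect on homogeneous parts. *)
Lemma clifford_presentation (k : fieldType) n (S : cgAlg k) (F : 'I_n -> 'M[k]_n) :
  graded_iso (@cg_gr k S) (clifford_gr F) ->
  exists phi : {lrmorphism clifford_free k n -> S},
    (forall p, phi p = 0 <-> ideal_gen (clifford_rel F) p) /\
    forall d, (phi @` free_gr (@clifford_wt n) d = @cg_gr k S d)%classic.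
Proof.
case=> f [[g fK gK] f_gr].
have g_lin : linear g by exact: can2_linear.
have g_mon : monoid_morphism g by exact: can2_monoid_morphism.
pose g' : {lrmorphism clifford_alg F -> S} := HB.pack g
  (GRing.isLinear.Build _ _ _ _ g g_lin) (GRing.isMonoidMorphism.Build _ _ g g_mon).
exists (g' \o quot_pi (clifford_ideal F)); split=> [p|d] /=.
  rewrite -[X in _ <-> X](quot_pi_eq0 (clifford_ideal F)).
  split=> [gp|->]; last exact: (rmorph0 g').
  by rewrite -[LHS]gK gp rmorph0.
apply/seteqP; split=> [_ /= [p hp <-]|a ha].
  have : (f @` @cg_gr k S d)%classic (quot_pi (clifford_ideal F) p).
    by rewrite f_gr; exists p.
  by case=> a ha <-; rewrite fK.
have : (f @` @cg_gr k S d)%classic (f a) by exists a.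
by rewrite f_gr => -[p hp e]; exists p => //=; rewrite e fK.
Qed.

(** * Periodic resolutions *)

Section Range.
Context (R : pzRingType) (M N : lmodType R) (p : {linear M -> N}).

Definition range_pred : {pred N} := [pred y | `[< exists x, p x = y >]].

Fact range_submod : submod_closed range_pred.
Proof.
split=> [|a _ _ /asboolP[x <-] /asboolP[y <-]]; apply/asboolP.
  by exists 0; rewrite linear0.
by exists (a *: x + y); rewrite linearP.
Qed.

HB.instance Definition _ := GRing.isSubmodClosed.Build R N range_pred range_submod.

Record range_mod := RangeMod { range_val : N; _ : range_val \in range_pred }.

HB.instance Definition _ := [isSub for range_val].
HB.instance Definition _ := [Choice of range_mod by <:].
HB.instance Definition _ := [SubChoice_isSubLmodule of range_mod by <:].

End Range.

Section ProjectiveLifting.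
Context (R : pzRingType) (M N : lmodType R) (p : {linear M -> N}).

Lemma range_corestrict (P : lmodType R) (f : {linear P -> N}) :
  (forall x, exists y, p y = f x) ->
  exists f' : {linear P -> range_mod p}, forall x, val (f' x) = f x.
Proof.
move=> pf; have fR x : f x \in range_pred p by apply/asboolP; exact: pf.
pose h x := RangeMod (fR x).
have h_lin : linear h by move=> a x y; apply: val_inj; rewrite /= !linearP.
pose h' : {linear P -> range_mod p} :=
  HB.pack h (GRing.isLinear.Build _ _ _ _ h h_lin).
by exists h'.
Qed.

(** [projective] lifts along surjections only, so both maps are first corestricted to the image of
    [p], made into a module of its own. *)
Lemma projective_lift (P : lmodType R) (f : {linear P -> N}) :
  projective P -> (forall x, exists y, p y = f x) ->
  exists g : {linear P -> M}, forall x, p (g x) = f x.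
Proof.
move=> projP /range_corestrict[f' f'E].
have [p' p'E] : exists p' : {linear M -> range_mod p}, forall x, val (p' x) = p x.
  by apply: range_corestrict => x; exists x.
have [|g gE] := projP _ _ p' f'.
  move=> [y hy]; have /asboolP[x xy] := hy; exists x; by apply: val_inj; rewrite p'E.
by exists g => x; rewrite -f'E -gE /= p'E.
Qed.

End ProjectiveLifting.

(* The left ideal [R x] has the periodic resolution with all terms [R] and all
   differentials equal to right multiplication by [x]. Comparing it in both
   directions with a projective resolution [P] gives [p_i : P i] and
   [g_i : P i -> R] for which [g_i p_i - 1] is null-homotopic, hence lies in
   [J]; so no [P i] vanishes. *)
Lemma periodic_infinite_gldim (R : nzRingType) (x : R) (J : set R) (n : nat) :
  two_sided_ideal J -> J x -> ~ J 1 -> x * x = 0 ->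
  (forall s, s * x = 0 -> exists t, s = t * x) ->
  ~ (forall M : lmodType R, projdim_le M n).
Proof.
move=> [J0 JD JMl JMr] Jx J1 xx0 xann gl.
pose mulx (a : R^o) : R^o := a * x.
have mulx_lin : linear mulx.
  by move=> a b c; rewrite /mulx mulrDl -mulrA.
pose m : {linear R^o -> R^o} :=
  HB.pack mulx (GRing.isLinear.Build _ _ _ _ mulx mulx_lin).
have [P [d [eps [[eps_surj ex0 ex] projP P0]]]] := gl (range_mod m).
have val_lin : linear (fun t => val (eps t) : R^o).
  by move=> a s t; rewrite !linearP.
pose e : {linear P 0%N -> R^o} :=
  HB.pack (fun t => val (eps t) : R^o) (GRing.isLinear.Build _ _ _ _ _ val_lin).
(* The second condition supplies the next [p]. The third places the image of [g \o d i] in the left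
   annihilator of [x], which is the image of [m], so that [g] lifts one degree further. *)
have main i : exists (p : P i) (g : {linear P i -> R^o}),
    [/\ exists c c', g p = 1 + c * x + x * c',
        exists p', d i p' = x *: p & forall t, g (d i t) * x = 0].
  elim: i => [|i [p [g [[c [c' gp]] [p' dp'] gd]]]].
    have [|g gE] := @projective_lift _ _ _ m _ e (projP 0%N).
      by move=> t; have /asboolP[y yE] := valP (eps t); exists y.
    have xR : (x : R^o) \in range_pred m.
      by apply/asboolP; exists 1; exact: mul1r.
    have [p pE] := eps_surj (RangeMod xR).
    exists p, g; split.
    - have /xann[c cE] : (g p - 1) * x = 0.
        by rewrite mulrBl mul1r [X in X - _](gE p) /= pE subrr.
      by exists c, 0; rewrite mulr0 addr0 -cE addrC subrK.
    - apply/(ex0 (x *: p)); rewrite linearZ /= pE; apply: val_inj => /=.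
      exact: xx0.
    - move=> t; rewrite [LHS](gE (d 0%N t)) /=.
      by have /(ex0 (d 0%N t)) -> : exists y, d 0%N y = d 0%N t by exists t.
  have [|g' g'E] := @projective_lift _ _ _ m _ (g \o d i) (projP i.+1).
    by move=> t; have /xann[y yE] := gd t; exists y; exact/esym.
  exists p', g'; split.
  (* Here [g' p' * x = g (d i p') = x * g p = x + x * c * x], since [x * x = 0] kills the term with
     [c']. *)
  - have /xann[b bE] : (g' p' - 1 - x * c) * x = 0.
      rewrite mulrBl mulrBl mul1r [X in X - _ - _](g'E p') /= dp' linearZ /=.
      by rewrite gp /GRing.scale /= !mulrDr mulr1 !mulrA xx0 mul0r addr0 addrAC addrK subrr.
    by exists b, c; rewrite -bE -addrA subrK addrC subrK.
  - apply/(ex i (x *: p')); rewrite linearZ /= dp' scalerA xx0 scale0r//.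
  - move=> t; rewrite [LHS](g'E (d i.+1 t)) /=.
    by have /(ex i (d i.+1 t)) -> : exists y, d i.+1 y = d i.+1 t; [exists t|rewrite linear0].
(* [P n.+1 = 0] forces [g p = 0], which puts [1 = - (c * x + x * c')] in [J]. *)
have [p [g [[c [c' gp]] _ _]]] := main n.+1.
apply: J1; have : J (- (c * x + x * c')).
  by rewrite -mulN1r; apply/JMl/JD; [exact: JMl|exact: JMr].
rewrite (P0 _ (ltnSn n) p) linear0 -addrA in gp; move/eqP: gp.
by rewrite eq_sym addr_eq0 => /eqP <-.
Qed.

(** * Generators of a graded Clifford algebra *)

Section CliffordGenerators.
Context (k : fieldType) (n : nat) (S : cgAlg k) (F : 'I_n -> 'M[k]_n).
Context (phi : {lrmorphism clifford_free k n -> S}).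
Hypothesis phi_ker : forall p, phi p = 0 <-> ideal_gen (clifford_rel F) p.
Hypothesis phi_gr :
  forall d, (phi @` free_gr (@clifford_wt n) d = @cg_gr k S d)%classic.

Let x (i : 'I_n) : S := phi (clifford_x k i).
Let y (i : 'I_n) : S := phi (clifford_y k i).

Lemma clifford_phi_surj s : exists p, phi p = s.
Proof.
have [l [u [_ hu ->]]] := ds_decomp (cg_ds S) s.
have /choice[p pE] i : exists p, phi p = u i.
  by have := hu i; rewrite -phi_gr => -[p _ <-]; exists p.
by exists (\sum_(i <- l) p i); rewrite raddf_sum; apply: eq_bigr => i _; exact: pE.
Qed.

Lemma clifford_phi_rel p : clifford_rel F p -> phi p = 0.
Proof. by move=> Fp; apply/phi_ker; exact: sub_ideal_gen. Qed.

Lemma clifford_x_anticomm i j : x i * x j + x j * x i = \sum_m F m i j *: y m.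
Proof.
apply/eqP; rewrite -subr_eq0 -!rmorphM -rmorphD.
rewrite (_ : \sum_m _ = phi (\sum_m F m i j *: clifford_y k m)); last first.
  by rewrite raddf_sum; apply: eq_bigr => m _; rewrite /= linearZ.
rewrite -[X in X == _](raddfB phi); apply/eqP/clifford_phi_rel.
by exists i, j; constructor 1.
Qed.

Lemma clifford_ind (P : S -> Prop) :
  P 0 -> P 1 -> (forall a s t, P s -> P t -> P (a *: s + t)) ->
  (forall i s, P s -> P (x i * s)) -> (forall i s, P s -> P (y i * s)) ->
  forall s, P s.
Proof.
move=> P0 P1 PD Px Py s; have [p <-] := clifford_phi_surj s.
elim/free_ind: p => [||a p q|i p Pp]; rewrite ?linear0 ?rmorph1//.
  by rewrite linearP; exact: PD.
by rewrite rmorphM; case: i => i; [exact: Px|exact: Py].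
Qed.

Lemma clifford_y_central i : center (y i).
Proof.
elim/clifford_ind => [||a s t ys yt|j s ys|j s ys]; rewrite /GRing.comm.
- by rewrite mulr0 mul0r.
- by rewrite mulr1 mul1r.
- by rewrite mulrDr mulrDl -scalerAr -scalerAl ys yt.
- have : x j * y i - y i * x j = 0.
    rewrite -[LHS](rmorph_commutator phi); apply: clifford_phi_rel.
    by exists j, i; constructor 2.
  by move/subr0_eq => xy; rewrite mulrA -xy -[LHS]mulrA ys -[RHS]mulrA.
- have : y i * y j - y j * y i = 0.
    rewrite -[LHS](rmorph_commutator phi); apply: clifford_phi_rel.
    by exists i, j; constructor 3.
  by move/subr0_eq => yy; rewrite mulrA yy -[LHS]mulrA ys -[RHS]mulrA.
Qed.

Lemma clifford_x_gr i : cg_gr 1 (x i).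
Proof.
rewrite -phi_gr; exists (clifford_x k i) => //.
by have := @free_gr_prod k _ (@clifford_wt n) [:: inl i]; rewrite !big_seq1.
Qed.

Lemma clifford_y_gr i : cg_gr 2 (y i).
Proof.
rewrite -phi_gr; exists (clifford_y k i) => //.
by have := @free_gr_prod k _ (@clifford_wt n) [:: inr i]; rewrite !big_seq1.
Qed.

(** A word of weight 2 is a single [y] or a product of two [x]. The coefficients are in general not
    unique, as anticommutators of the [x i] are combinations of the [y m]. *)
Lemma clifford_deg2 s : cg_gr 2 s -> exists (a : 'I_n -> k) (b : 'I_n -> 'I_n -> k),
  s = \sum_m a m *: y m + \sum_i \sum_j b i j *: (x i * x j).
Proof.
rewrite -phi_gr => -[p hp <-]; elim/free_gr_ind: hp => {p} [|c p q|l].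
- exists (fun=> 0), (fun _ _ => 0); rewrite linear0 big1 ?big1 ?addr0//.
    by move=> i _; rewrite big1// => j _; rewrite scale0r.
  by move=> i _; rewrite scale0r.
- move=> [a [b e]] [a' [b' e']].
  exists (fun m => c * a m + a' m), (fun i j => c * b i j + b' i j).
  rewrite linearP /= e e' scalerDr addrACA; congr (_ + _).
    rewrite scaler_sumr -big_split; apply: eq_bigr => m _.
    by rewrite scalerDl scalerA.
  rewrite scaler_sumr -big_split; apply: eq_bigr => i _.
  rewrite scaler_sumr -big_split; apply: eq_bigr => j _.
  by rewrite scalerDl scalerA.
have sum0 : \sum_(i < n) \sum_(j < n) (0 : k) *: (x i * x j) = 0.
  by rewrite big1// => i _; rewrite big1// => j _; rewrite scale0r.
case: l => [|[i|i] [|[j|j] [|v l]]]; rewrite ?big_cons ?big_nil//=.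
- move=> _; exists (fun=> 0), (fun i' j' => ((i' == i) && (j' == j))%:R).
  rewrite mulr1 rmorphM big1 => [|m _]; last by rewrite scale0r.
  rewrite add0r (bigD1 i)//= (bigD1 j)//= !eqxx scale1r !big1 ?addr0//.
    by move=> i' /negPf i'i; rewrite big1// => j' _; rewrite i'i scale0r.
  by move=> j' /negPf ->; rewrite scale0r.
- by case: v => v; rewrite /=; lia.
- move=> _; exists (fun m => (m == i)%:R), (fun _ _ => 0).
  rewrite mulr1 sum0 addr0 (bigD1 i)//= eqxx scale1r big1 ?addr0// => m /negPf ->.
  by rewrite scale0r.
Qed.

(* Contraction with a linear form [f] on the span of the generators [x i]. It
   is the lower left entry of the homomorphism to 2 x 2 matrices that sends
   [x i] to [[x i, 0], [f i, - x i]] and [y i] to [[y i, 0], [0, y i]]. *)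
Lemma clifford_contraction (f : 'I_n -> k) : exists delta : S -> S,
  [/\ linear delta, delta 1 = 0,
      forall i s, delta (x i * s) = f i *: s - x i * delta s
    & forall i s, delta (y i * s) = y i * delta s].
Proof.
have mulE (A B : 'M[S]_2) i j : (A * B) i j = A i 0 * B 0 j + A i 1 * B 1 j.
  by rewrite mxE !big_ord_recl big_ord0 addr0; congr (_ + A i _ * B _ j); apply: val_inj.
(* For lower triangular matrices with diagonals [u, - u] and [v, - v] and scalar corners [a] and
   [b], the corners of [A * B] and [B * A] cancel, which leaves the scalar matrix of
   [u * v + v * u]. *)
have anti_mx (u v : S) (a b : k) (A B C : 'M[S]_2) :
    A 0 0 = u -> A 0 1 = 0 -> A 1 0 = a%:A -> A 1 1 = - u ->
    B 0 0 = v -> B 0 1 = 0 -> B 1 0 = b%:A -> B 1 1 = - v ->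
    (forall i j, C i j = (u * v + v * u) *+ (i == j)) -> A * B + B * A - C = 0.
  move=> A00 A01 A10 A11 B00 B01 B10 B11 CE; apply/matrixP => i j.
  rewrite mxE [X in X + _]mxE [X in _ + X]mxE CE !mulE [RHS]mxE.
  have e2 (l : 'I_2) : l = 0 \/ l = 1.
    by case: l => -[|[|//]] ll; [left|right]; apply: val_inj.
  have [-> | ->] := e2 i; have [-> | ->] := e2 j;
    rewrite ?A00 ?A01 ?A10 ?A11 ?B00 ?B01 ?B10 ?B11.
  - by rewrite !mul0r !addr0 subrr.
  - by rewrite !mulr0 !mul0r !addr0 subrr.
  - rewrite subr0 !mulr_algl !mulNr !mulr_algr.
    by rewrite addrA subrK subrr.
  - by rewrite !mulr0 !add0r !mulrNN mulr1n subrr.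
pose c : {rmorphism k -> 'M[S]_2} := (@scalar_mx S 2) \o (in_alg S).
have scalE z (A : 'M[S]_2) i j : (z%:M * A) i j = z * A i j.
  by rewrite [_ * _]mul_scalar_mx mxE.
have scalC z (A : 'M[S]_2) : center z -> GRing.comm (z%:M : 'M[S]_2) A.
  move=> zC; apply/matrixP => i j; rewrite scalE mxE (bigD1 j)//= big1 => [|l /negPf lj].
    by rewrite addr0 mxE eqxx mulr1n zC.
  by rewrite mxE lj mulr0n mulr0.
have cC a A : GRing.comm (c a) A.
  by apply: scalC => s; rewrite /GRing.comm mulr_algl mulr_algr.
pose h (u : 'I_n + 'I_n) : 'M[S]_2 := match u with
  | inl i => \matrix_(a, b) (if b == 0 then (if a == 0 then x i else (f i)%:A)
                             else if a == 0 then 0 else - x i)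
  | inr i => (y i)%:M end.
have [psi [psiZ psi_x psi_y]] : exists psi : {rmorphism clifford_free k n -> 'M[S]_2},
    [/\ forall a p, psi (a *: p) = c a * psi p,
        forall i, psi (clifford_x k i) = h (inl i)
      & forall i, psi (clifford_y k i) = (y i)%:M].
  pose psi0 := free_eval c h.
  pose psi : {rmorphism clifford_free k n -> 'M[S]_2} := HB.pack psi0
    (GRing.isZmodMorphism.Build _ _ psi0 (free_eval_zmod c h))
    (GRing.isMonoidMorphism.Build _ _ psi0 (free_eval_monoid h cC)).
  exists psi; split=> [a p|i|i]; first exact: free_evalZ.
    exact: free_eval_gen.
  exact: free_eval_gen.
have {psiZ} psiZ a p i j : psi (a *: p) i j = a *: psi p i j.
  by rewrite psiZ [LHS]scalE mulr_algl.
have psi_x00 i : psi (clifford_x k i) 0 0 = x i by rewrite psi_x mxE.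
have psi_x01 i : psi (clifford_x k i) 0 1 = 0 by rewrite psi_x mxE.
have psi_x10 i : psi (clifford_x k i) 1 0 = (f i)%:A by rewrite psi_x mxE.
have psi_x11 i : psi (clifford_x k i) 1 1 = - x i by rewrite psi_x mxE.
have psi_yM i A a b : (psi (clifford_y k i) * A) a b = y i * A a b.
  by rewrite psi_y scalE.
have psi_yC i A : psi (clifford_y k i) * A = A * psi (clifford_y k i).
  by rewrite psi_y; apply: scalC; exact: clifford_y_central.
have psi_y0 i a b : psi (clifford_y k i) a b = y i *+ (a == b).
  by rewrite psi_y mxE.
move: psi psiZ psi_x00 psi_x01 psi_x10 psi_x11 psi_yM psi_yC psi_y0 {psi_x psi_y}.
move=> psi psiZ psi_x00 psi_x01 psi_x10 psi_x11 psi_yM psi_yC psi_y0.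
clear h scalC cC scalE c.
have psiM p q : psi (p * q) = psi p * psi q := rmorphM psi p q.
have psi_comm p q : psi p * psi q = psi q * psi p -> psi (p * q - q * p) = 0.
  by move=> pq; rewrite rmorph_commutator pq subrr.
have psi_ker p : phi p = 0 -> psi p = 0.
  move=> /phi_ker; apply: (@ideal_gen_min _ _ [set q | psi q = 0]%classic).
    exact: ker_ideal.
  move=> _ [i [j [] ->]]; rewrite /mkset; last 2 first.
  - by apply: psi_comm; exact: (esym (psi_yC j _)).
  - by apply: psi_comm; exact: (psi_yC i _).
  have sumE a b : (psi (\sum_m F m i j *: clifford_y k m)) a b =
      (x i * x j + x j * x i) *+ (a == b).
    rewrite raddf_sum summxE clifford_x_anticomm -sumrMnl.
    by apply: eq_bigr => m _; rewrite [LHS]psiZ psi_y0 scalerMnr.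
  rewrite rmorph_anticomm; exact: (anti_mx (x i) (x j) (f i) (f j)).
(* The first row of [psi p] is [(phi p, 0)]; this makes the lower left entry of
   [psi (clifford_x k i * p)] equal to [f i *: phi p - x i * psi p 1 0]. *)
have psi0E p : psi p 0 0 = phi p /\ psi p 0 1 = 0.
  elim/free_ind: p => [||a p q [p0 p1] [q0 q1]|[i|i] p [p0 p1]].
  - by rewrite !rmorph0 !mxE.
  - by rewrite !rmorph1 !mxE.
  - by rewrite rmorphD linearP !mxE !psiZ p0 p1 q0 q1 scaler0 addr0.
  - rewrite -/(clifford_x k i) psiM (rmorphM phi) !mulE.
    by rewrite psi_x00 psi_x01 p0 p1 !mul0r mulr0 !addr0.
  - rewrite -/(clifford_y k i) psiM (rmorphM phi).
    by rewrite !psi_yM p0 p1 mulr0.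
have [sec secK] := choice clifford_phi_surj.
have secE p : psi (sec (phi p)) = psi p.
  apply/eqP; rewrite -subr_eq0 -rmorphB; apply/eqP/psi_ker.
  by rewrite rmorphB /= secK subrr.
exists (fun s => psi (sec s) 1 0); split.
- move=> a s t.
  have -> : a *: s + t = phi (a *: sec s + sec t) by rewrite linearP /= !secK.
  by rewrite secE rmorphD mxE psiZ.
- by rewrite -[X in sec X](rmorph1 phi) secE rmorph1 mxE.
- move=> i s; have -> : x i * s = phi (clifford_x k i * sec s) by rewrite rmorphM /= secK.
  rewrite secE psiM mulE psi_x10 psi_x11 (psi0E _).1 secK mulr_algl.
  by rewrite mulNr.
- move=> i s; have -> : y i * s = phi (clifford_y k i * sec s) by rewrite rmorphM /= secK.
  by rewrite secE psiM psi_yM.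
Qed.

Hypothesis two_neq0 : 2%:R != 0 :> k.

Lemma double_eq0 (s : S) : s + s = 0 -> s = 0.
Proof.
move=> ss0; rewrite -[s]scale1r -(mulVf two_neq0) -scalerA.
by rewrite scaler_nat [s *+ 2]mulr2n ss0 scaler0.
Qed.

(** With [X = \sum_i v i *: x i], the anticommutator [X * x j + x j * X] is the combination of the
    [y m] with coefficients [\sum_i v i * F m i j], hence zero. A contraction with [delta X = 1]
    then satisfies [delta (X * s) = s - X * delta s], so [X * s = 0] gives [s = X * delta s]. *)
Lemma clifford_nondegenerate (d : nat) : gldim_le S d ->
  forall v : 'I_n -> k, (forall m j, \sum_i v i * F m i j = 0) -> forall i, v i = 0.
Proof.
move=> gl v vF i; apply/eqP/negPn/negP => vi.
pose X := \sum_i v i *: x i.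
have Xl s : X * s = \sum_l v l *: (x l * s).
  by rewrite mulr_suml; apply: eq_bigr => l _; rewrite scalerAl.
have Xr s : s * X = \sum_l v l *: (s * x l).
  by rewrite mulr_sumr; apply: eq_bigr => l _; rewrite scalerAr.
have Xx j : X * x j + x j * X = 0.
  rewrite Xl Xr -big_split /=.
  under eq_bigr => l _.
    rewrite -scalerDr clifford_x_anticomm scaler_sumr.
    under eq_bigr do rewrite scalerA.
    over.
  rewrite exchange_big big1// => m _.
  by rewrite -scaler_suml vF scale0r.
have XX : X * X = 0.
  apply: double_eq0; rewrite [Z in Z + _]Xr [Z in _ + Z]Xl -big_split big1//= => j _.
  by rewrite -scalerDr Xx scaler0.
(* The form is supported at [i] with value [(v i)^-1], so it takes the value 1 on [X]. *)
have [delta [dlin _ dx _]] := clifford_contraction (fun l => (v i)^-1 *+ (l == i)).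
pose delta' : {linear S -> S} :=
  HB.pack delta (GRing.isLinear.Build _ _ _ _ delta dlin).
have dX s : delta (X * s) = s - X * delta s.
  rewrite Xl -[delta]/(delta' : S -> S) raddf_sum /=.
  under eq_bigr => l _ do rewrite -[delta]/(delta' : S -> S) linearZ /= dx scalerBr scalerA.
  rewrite sumrB (bigD1 i)//= eqxx divff// scale1r big1 ?addr0 => [|l /negPf li].
    by congr (_ - _); rewrite Xl.
  by rewrite li mulr0n mulr0 scale0r.
(* Products are reversed in [S^c]: left multiples and the left annihilator of [X] there are right
   ones in [S]. The proper ideal containing [X] is the irrelevant ideal. *)
apply: (@periodic_infinite_gldim (S^c) X (@irrelevant k S) d) gl => //.
- have [J0 JD JMl JMr] := ideal_genP [set a | exists2 i, (0 < i)%N & @cg_gr k S i a]%classic.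
  by split=> // a b h; [exact: JMr|exact: JMl].
- apply: sub_ideal_gen; exists 1%N => //.
  apply: (ds_sum (cg_ds S)) => l _.
  rewrite -mulr_algl; apply: (@cg_mul k S 0 1); last exact: clifford_x_gr.
  by rewrite cg_conn; exists (v l).
- exact: irrelevant1.
- move=> s Xs; exists (delta s); apply/eqP; rewrite -subr_eq0 -dX.
  rewrite [Z in delta Z](Xs : X * s = 0).
  by rewrite -[delta]/(delta' : S -> S) linear0.
Qed.

(** The commutator of the quadratic part [q] with [x l] is [\sum_i (\sum_j (b i j - b j i) *: B j l)
    * x i]. Contraction with the coordinate form of [x i] isolates each coefficient, independence of
    [y] gives [\sum_j (b i j - b j i) * F m j l = 0], and nondegeneracy makes [b] symmetric. *)
Lemma clifford_central_deg2 :
  (forall v : 'I_n -> k,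
     (forall m j, \sum_i v i * F m i j = 0) -> forall i, v i = 0) ->
  lin_indep y -> forall u, center u -> cg_gr 2 u ->
  exists a : 'I_n -> k, u = \sum_m a m *: y m.
Proof.
move=> nondeg yi u uC /clifford_deg2[a [b]]; set q := \sum_i \sum_j _ => uE.
pose B i j := \sum_m F m i j *: y m.
have BC i j : center (B i j).
  move=> s; rewrite /GRing.comm mulr_suml mulr_sumr; apply: eq_bigr => m _.
  by rewrite -scalerAl -scalerAr clifford_y_central.
have qC : center q.
  have -> : q = u - \sum_m a m *: y m by rewrite uE addrC addKr.
  move=> s; rewrite /GRing.comm mulrBl mulrBr uC mulr_suml mulr_sumr; congr (_ - _).
  by apply: eq_bigr => m _; rewrite -scalerAl -scalerAr clifford_y_central.
have beta0 i j : b i j - b j i = 0.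
  apply: (nondeg (fun j => b i j - b j i)) => m l; move: m.
  pose c i m := \sum_j (b i j - b j i) * F m j l.
  have cE i' : \sum_m c i' m *: y m = \sum_j (b i' j - b j i') *: B j l.
    under eq_bigr do rewrite scaler_suml.
    rewrite exchange_big; apply: eq_bigr => j' _; rewrite scaler_sumr.
    by apply: eq_bigr => m _; rewrite scalerA.
  (* The trailing factor [1] gives each term the form [x i' * s] to which the contraction rule
     applies. *)
  have sum0 : \sum_i' \sum_m c i' m *: (y m * (x i' * 1)) = 0.
    transitivity (q * x l - x l * q); last by rewrite qC subrr.
    under eq_bigr => i' _.
      under eq_bigr do rewrite mulr1 scalerAl.
      rewrite -mulr_suml cE.
      under eq_bigr do rewrite scalerBl.
      rewrite sumrB mulrBl.
      over.
    rewrite sumrB /q !mulr_suml !mulr_sumr.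
    rewrite (_ : \sum_i0 (\sum_i1 b i1 i0 *: B i1 l) * x i0 =
      \sum_i0 \sum_i1 b i0 i1 *: (B i0 l * x i1)); last first.
      rewrite [RHS]exchange_big; apply: eq_bigr => i0 _; rewrite mulr_suml.
      by apply: eq_bigr => i1 _; rewrite scalerAl.
    rewrite -!sumrB; apply: eq_bigr => i0 _; rewrite !mulr_suml !mulr_sumr -!sumrB.
    apply: eq_bigr => i1 _; rewrite -!scalerAl -!scalerAr -!scalerBr; congr (_ *: _).
    rewrite [B i1 l * x i0]BC /B.
    rewrite -(clifford_x_anticomm i0) -(clifford_x_anticomm i1) mulrDr mulrDl !mulrA.
    by rewrite opprD addrA addrK.
  have [delta [dlin d1 dx dy]] := clifford_contraction (fun l => (l == i)%:R).
  pose delta' : {linear S -> S} :=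
    HB.pack delta (GRing.isLinear.Build _ _ _ _ delta dlin).
  move: (congr1 delta' sum0); rewrite linear0 raddf_sum.
  rewrite (bigD1 i)//= [X in _ + X]big1 ?addr0 => [|i' /negPf i'i]; last first.
    rewrite -[delta]/(delta' : S -> S) raddf_sum big1// => m _.
    rewrite /= -[delta]/(delta' : S -> S) linearZ /=.
    by rewrite dy dx i'i d1 mulr0 subr0 scale0r mulr0 scaler0.
  rewrite -[delta]/(delta' : S -> S) raddf_sum => h; apply: (yi (c i)); rewrite -[RHS]h.
  apply: eq_bigr => m _.
  by rewrite /= -[delta]/(delta' : S -> S) linearZ /= dy dx eqxx d1 mulr0 subr0 scale1r mulr1.
(* As [b] is symmetric, [q] is half of [\sum_i \sum_j b i j *: B i j]. *)
exists (fun m => a m + \sum_i \sum_j 2%:R^-1 * b i j * F m i j).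
rewrite uE; under [RHS]eq_bigr do rewrite scalerDl.
rewrite big_split; congr (_ + _) => /=.
have -> : q = 2%:R^-1 *: (q + q).
  by rewrite -mulr2n -scaler_nat scalerA mulVf// scale1r.
transitivity (\sum_i \sum_j (2%:R^-1 * b i j) *: B i j); last first.
  under [RHS]eq_bigr do rewrite scaler_suml.
  rewrite [RHS]exchange_big; apply: eq_bigr => i _.
  under [RHS]eq_bigr do rewrite scaler_suml.
  rewrite [RHS]exchange_big; apply: eq_bigr => j _.
  by rewrite scaler_sumr; apply: eq_bigr => m _; rewrite scalerA.
rewrite {2}/q exchange_big -big_split scaler_sumr; apply: eq_bigr => i _.
rewrite -big_split scaler_sumr; apply: eq_bigr => j _ /=.
have /eqP := beta0 i j; rewrite subr_eq0 => /eqP <-.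
by rewrite -scalerDr clifford_x_anticomm scalerA.
Qed.

End CliffordGenerators.

(** * Spans and dimension *)

Lemma central_mul_prod (A : pzRingType) (I : eqType) (l : seq I) (G G' : I -> A) j z :
  center z -> uniq l -> j \in l -> G' j = z * G j ->
  (forall i, i != j -> G' i = G i) ->
  \prod_(i <- l) G' i = z * \prod_(i <- l) G i.
Proof.
move=> zC + + G'j G'G; elim: l => [//|i l IHl] /= /andP[il ul].
rewrite inE !big_cons; have [ji _|ji /= jl] := eqVneq j i.
  rewrite -ji G'j -mulrA; congr (_ * (_ * _)); apply: eq_big_seq => i' i'l.
  by rewrite G'G//; apply: contraNneq il => i'j; rewrite -ji -i'j.
by rewrite G'G 1?eq_sym// IHl// !mulrA zC.
Qed.

Inductive lspan (k : pzRingType) (V : lmodType k) (X : V -> Prop) : V -> Prop :=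
| lspan0 : lspan X 0
| lspanD c a b : X a -> lspan X b -> lspan X (c *: a + b).

Section Lspan.
Context (k : pzRingType) (V : lmodType k).
Implicit Types X Y : V -> Prop.

Lemma lspan_linear X c a b : lspan X a -> lspan X b -> lspan X (c *: a + b).
Proof.
elim=> [|c' a' a'' Xa _ IH] Xb; first by rewrite scaler0 add0r.
by rewrite scalerDr scalerA -addrA; apply: lspanD => //; exact: IH.
Qed.

Lemma lspan_sub X a : X a -> lspan X a.
Proof.
move=> Xa; rewrite -[a]addr0 -[a]scale1r.
by apply: lspanD => //; exact: lspan0.
Qed.

End Lspan.

Lemma lspan_mul (k : comNzRingType) (A : algType k) (X Y : A -> Prop) z a :
  (forall b, X b -> lspan Y (z * b)) -> lspan X a -> lspan Y (z * a).
Proof.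
move=> XY; elim=> [|c b b' Xb _ IH]; first by rewrite mulr0; exact: lspan0.
by rewrite mulrDr -scalerAr; apply: lspan_linear => //; exact: XY.
Qed.

(** The transition matrices to and from a basis satisfy [MB *m MA = 1], hence [MA *m MB = 1] because
    they are square; a relation among the [v i] is a row killed by [MA]. *)
Lemma has_dim_lin_indep (k : fieldType) (V : lmodType k) (W : V -> Prop) (N : nat)
    (v : 'I_N -> V) :
  has_dim W N -> (forall i, W (v i)) ->
  (forall s, W s -> exists c : 'I_N -> k, s = \sum_i c i *: v i) -> lin_indep v.
Proof.
move=> [b [Wb bi bspan]] Wv vspan.
have /choice[A AE] i : exists c : 'I_N -> k, v i = \sum_j c j *: b j by exact: bspan.
have /choice[B BE] i : exists c : 'I_N -> k, b i = \sum_j c j *: v j by exact: vspan.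
pose MA := \matrix_(i, j) A i j; pose MB := \matrix_(i, j) B i j.
have mulE (C D : 'I_N -> 'I_N -> k) (u u' u'' : 'I_N -> V) :
    (forall i, u i = \sum_j C i j *: u' j) -> (forall i, u' i = \sum_j D i j *: u'' j) ->
    forall i, u i = \sum_j (\sum_l C i l * D l j) *: u'' j.
  move=> uE u'E i; rewrite uE; under eq_bigr do rewrite u'E scaler_sumr.
  rewrite exchange_big; apply: eq_bigr => j _; rewrite scaler_suml.
  by apply: eq_bigr => l _; rewrite scalerA.
have BA : MB *m MA = 1%:M.
  apply/matrixP => i j; rewrite !mxE.
  under eq_bigr do rewrite !mxE.
  apply/eqP; rewrite -subr_eq0; apply/eqP.
  apply: (bi (fun j => \sum_l B i l * A l j - (i == j)%:R)).
  under eq_bigr do rewrite scalerBl.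
  rewrite sumrB -(mulE _ _ _ _ _ BE AE) (bigD1 i)//= eqxx scale1r big1.
    by rewrite addr0 subrr.
  by move=> l /negPf il; rewrite eq_sym il scale0r.
have AB := mulmx1C BA.
move=> c c0 i; pose C := \row_i c i.
have CA : C *m MA = 0.
  apply/rowP => j; rewrite !mxE; under eq_bigr do rewrite !mxE.
  have := mulE (fun=> c) A (fun=> \sum_l c l *: v l) v b (fun=> erefl) AE i.
  by rewrite c0 => /esym/bi.
have : C = 0 by rewrite -[C]mulmx1 -AB mulmxA CA mul0mx.
by move=> /rowP/(_ i); rewrite !mxE.
Qed.

(** * Exponents of given degree and the Hilbert series *)

Section Exponents.
Context (n : nat).
Implicit Types e : {ffun 'I_n -> nat}.

Definition exp_add e j c : {ffun 'I_n -> nat} := [ffun i => e i + c * (i == j)]%N.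

Lemma exp_addE e j c i : exp_add e j c i = (e i + c * (i == j))%N.
Proof. exact: ffunE. Qed.

Definition exp_deg e := (\sum_i e i)%N.

(** In degree [d] no entry exceeds [d], so functions into ['I_d.+1] enumerate all exponents. *)
Definition exps (d : nat) : seq {ffun 'I_n -> nat} :=
  [seq [ffun i => nat_of_ord (f i)] |
    f : {ffun 'I_n -> 'I_d.+1} in [pred f : {ffun 'I_n -> 'I_d.+1} | \sum_i f i == d]%N].

Lemma exps_uniq d : uniq (exps d).
Proof.
rewrite map_inj_uniq ?enum_uniq// => f f' /ffunP ff'.
by apply/ffunP => i; apply: val_inj; have := ff' i; rewrite !ffunE.
Qed.

Lemma mem_exps d e : (e \in exps d) = (exp_deg e == d).
Proof.
apply/mapP/idP => [[f]|/eqP ed].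
  rewrite mem_enum inE => /eqP fd ->; rewrite -[X in _ == X]fd; apply/eqP.
  by apply: eq_bigr => i _; rewrite ffunE.
have ei i : (e i < d.+1)%N.
  by rewrite ltnS -ed /exp_deg (bigD1 i)//= leq_addr.
exists [ffun i => Ordinal (ei i)]; last first.
  by apply/ffunP => i; rewrite !ffunE.
rewrite mem_enum inE -[X in _ == X]ed; apply/eqP.
by apply: eq_bigr => i _; rewrite ffunE.
Qed.

(** Expanding the power gives one term ['X^(\sum_i f i)] for each function [f]. *)
Lemma size_exps d : (size (exps d))%:R = ((\sum_(j < d.+1) 'X^j) ^+ n : {poly int})`_d.
Proof.
rewrite size_map -cardE -sum1_card natr_sum.
rewrite -[in RHS](card_ord n) -prodr_const bigA_distr_bigA /= coef_sum.
rewrite big_mkcond; apply: eq_bigr => f _; rewrite inE.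
have -> : \prod_(i : 'I_n) 'X^(f i) = 'X^(\sum_i f i)%N :> {poly int}.
  by rewrite expr_sum.
by rewrite coefXn [in RHS]eq_sym; case: ifP.
Qed.

End Exponents.

(** Let [H] be the truncated Hilbert series and [Q] the power of the truncated geometric series.
    Modulo ['X^(d.+1)], both [H * (1 - 'X) ^+ n] and [(1 - 'X) ^+ n * Q = (1 - 'X^(d.+1)) ^+ n] are
    1, so [H] and [Q] agree in degree [d]. *)
Lemma hilbert_size_exps (k : fieldType) (S : cgAlg k) (n d : nat) :
  hilbert_inv_pow S n -> has_dim (@cg_gr k S d) (size (exps n d)).
Proof.
move=> [h [hdim hE]]; suff -> : size (exps n d) = h d by [].
pose H : {poly int} := \poly_(i < d.+1) (h i)%:Z.
pose Q : {poly int} := (\sum_(j < d.+1) 'X^j) ^+ n.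
pose U : {poly int} := H * (1 - 'X) ^+ n.
have UE m : (m <= d)%N -> U`_m = (m == 0%N)%:Z.
  move=> md; rewrite coefM -hE; apply: eq_bigr => i _; rewrite coef_poly ifT//.
  by rewrite ltnS (leq_trans _ md)// -ltnS.
have : (U * Q)`_d = (H * (1 - 'X^(d.+1)) ^+ n)`_d.
  have <- : (1 - 'X) * (\sum_(j < d.+1) 'X^j) = 1 - 'X^(d.+1) :> {poly int}.
    rewrite -[X in _ = X - _](expr1n _ d.+1) subrXX; congr (_ * _).
    by apply: eq_bigr => i _; rewrite expr1n mul1r.
  by rewrite exprMn mulrA.
have -> : (U * Q)`_d = Q`_d.
  rewrite coefM big_ord_recl /= UE// subn0 mul1r big1 ?addr0// => i _.
  by rewrite UE ?mul0r// /bump /= add1n.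
have [T ->] : exists T : {poly int}, (1 - 'X^(d.+1)) ^+ n = 1 + T * 'X^(d.+1).
  elim: n {hE Q U UE} => [|m [T e]]; first by exists 0; rewrite mul0r addr0.
  exists (T - 1 - T * 'X^(d.+1)); rewrite exprSr e; ring.
rewrite mulrDr mulr1 coefD mulrA coefMXn ltnSn addr0 coef_poly ltnSn -size_exps.
by rewrite natz => -[].
Qed.

Section GradedProducts.
Context (k : fieldType) (S : cgAlg k).

Lemma cg_grZ d c (a : S) : cg_gr d a -> cg_gr d (c *: a).
Proof.
move=> ha; rewrite -mulr_algl; apply: (@cg_mul k S 0 d) => //.
by rewrite cg_conn; exists c.
Qed.

Lemma cg_grX d (a : S) m : cg_gr d a -> cg_gr (d * m) (a ^+ m).
Proof.
move=> ha; elim: m => [|m IH]; first by rewrite muln0; exact: cg_one.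
by rewrite exprS mulnS; exact: cg_mul.
Qed.

Lemma cg_gr_prod (I : Type) (l : seq I) (d : I -> nat) (a : I -> S) :
  (forall i, cg_gr (d i) (a i)) ->
  cg_gr (\sum_(i <- l) d i)%N (\prod_(i <- l) a i).
Proof.
move=> ha; elim: l => [|i l IH]; first by rewrite !big_nil; exact: cg_one.
by rewrite !big_cons; exact: cg_mul.
Qed.

End GradedProducts.

(** * The monomial basis *)

Section MonomialBasis.
Context (k : fieldType) (n : nat) (S : cgAlg k) (x g : 'I_n -> S).
Hypothesis two_neq0 : 2%:R != 0 :> k.
Hypothesis x_gr : forall i, cg_gr 1 (x i).
Hypothesis g_gr : forall i, cg_gr 2 (g i).
Hypothesis g_central : forall i, center (g i).
Hypothesis x_anticomm : forall i j, exists c : 'I_n -> k,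
  x i * x j + x j * x i = \sum_m c m *: g m.
Hypothesis xg_ind : forall P : S -> Prop,
  P 0 -> P 1 -> (forall a s t, P s -> P t -> P (a *: s + t)) ->
  (forall i s, P s -> P (x i * s)) -> (forall i s, P s -> P (g i * s)) ->
  forall s, P s.
Hypothesis hilb : hilbert_inv_pow S n.

Implicit Types e : {ffun 'I_n -> nat}.

(** Only the [x i] with [i] in [l] occur, whereas all the [g i] do; this allows induction on [l] in
    the spanning argument. *)
Definition partial_mon (l : seq 'I_n) e : S :=
  (\prod_(i <- l) x i ^+ odd (e i)) * \prod_(i < n) g i ^+ (e i)./2.

(* The exponent [e i] of the monomial [e] is split as [odd (e i)] for [x i] and
   [(e i)./2] for [g i], so that multiplication by [g i] raises it by 2. *)
Definition cliff_mon := partial_mon (index_enum 'I_n).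

Let gC i s : g i * s = s * g i. Proof. exact: g_central. Qed.

Lemma partial_mon_mulg l e j : partial_mon l (exp_add e j 2) = g j * partial_mon l e.
Proof.
rewrite /partial_mon (eq_bigr (fun i => x i ^+ odd (e i))) => [|i _]; last first.
  by rewrite exp_addE oddD mul2n odd_double addbF.
rewrite mulrA [in RHS]gC -mulrA; congr (_ * _).
apply: (@central_mul_prod _ _ _ _ _ j); rewrite ?index_enum_uniq ?mem_index_enum//.
- by rewrite exp_addE eqxx muln1 -exprS addn2.
- by move=> i /negPf ij; rewrite exp_addE ij muln0 addn0.
Qed.

Lemma partial_mon_mulx l e i : i \notin l -> ~~ odd (e i) ->
  partial_mon (i :: l) (exp_add e i 1) = x i * partial_mon l e.
Proof.
move=> il ei; rewrite /partial_mon big_cons -!mulrA.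
rewrite exp_addE eqxx muln1 addn1 /= ei expr1; congr (_ * (_ * _)).
  apply: eq_big_seq => j jl; rewrite exp_addE.
  by have [ji|] := eqVneq j i; [rewrite -ji jl in il|rewrite muln0 addn0].
apply: eq_bigr => j _; rewrite exp_addE; congr (_ ^+ _).
have [->|_] := eqVneq j i; last by rewrite muln0 addn0.
by rewrite muln1 addn1 /= uphalf_half (negPf ei).
Qed.

Lemma cliff_mon_gr e : cg_gr (exp_deg e) (cliff_mon e).
Proof.
have -> : exp_deg e = (\sum_(i < n) odd (e i) + \sum_(i < n) 2 * (e i)./2)%N.
  rewrite -big_split; apply: eq_bigr => i _ /=.
  by rewrite mul2n odd_double_half.
apply: cg_mul; apply: cg_gr_prod => i; last exact/cg_grX/g_gr.
by have := cg_grX (odd (e i)) (x_gr i); rewrite mul1n.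
Qed.

Inductive central_span : S -> Prop :=
| central_span1 : central_span 1
| central_spanD c a b : central_span a -> central_span b -> central_span (c *: a + b)
| central_spanM j a : central_span a -> central_span (g j * a).

(** Ordered products of the [x i] along sublists of [l], with coefficients in the central subalgebra
    generated by the [g j]: [a] collects the terms without the head [x i], and [x i * b] those with
    it. *)
Fixpoint ext_span (l : seq 'I_n) (s : S) : Prop :=
  if l is i :: l' then
    exists a b, [/\ ext_span l' a, ext_span l' b & s = a + x i * b]
  else central_span s.

Lemma ext_spanD l c s t : ext_span l s -> ext_span l t -> ext_span l (c *: s + t).
Proof.
elim: l s t => [|i l IH] s t /=; first exact: central_spanD.
move=> [a [b [la lb ->]]] [a' [b' [la' lb' ->]]].
exists (c *: a + a'), (c *: b + b'); split; [exact: IH|exact: IH|].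
by rewrite mulrDr scalerDr addrACA scalerAr.
Qed.

Lemma ext_span0 l s : ext_span l s -> ext_span l 0.
Proof. by move=> ls; rewrite -(addNr s) -scaleN1r; exact: ext_spanD. Qed.

Lemma ext_spanM l j s : ext_span l s -> ext_span l (g j * s).
Proof.
elim: l s => [|i l IH] s /=; first exact: central_spanM.
move=> [a [b [la lb ->]]]; exists (g j * a), (g j * b).
split; [exact: IH|exact: IH|].
by rewrite mulrDr; congr (_ + _); rewrite !mulrA gC.
Qed.

Lemma ext_span_comb l (c : 'I_n -> k) s :
  ext_span l s -> ext_span l ((\sum_m c m *: g m) * s).
Proof.
move=> ls; rewrite mulr_suml; elim: (index_enum _) => [|m r IH].
  by rewrite big_nil; exact: ext_span0 ls.
rewrite big_cons -scalerAl; apply: ext_spanD => //; exact: ext_spanM.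
Qed.

Lemma ext_spanS i l s : ext_span l s -> ext_span (i :: l) s.
Proof.
move=> ls; exists s, 0; split=> //; first exact: ext_span0 ls.
by rewrite mulr0 addr0.
Qed.

(** [x j] is moved to its place by [x j * x i = (x j * x i + x i * x j) - x i * x j], where the
    bracket is a combination of the [g m]; once [i = j] is reached, [x i * x i] is half of such a
    combination. *)
Lemma ext_span_mulx l j s : j \in l -> ext_span l s -> ext_span l (x j * s).
Proof.
elim: l s => [//|i l IH] s jl [a [b [la lb ->]]].
have [c ijE] := x_anticomm j i.
move: jl; rewrite inE; case: (eqVneq j i) ijE => [-> iiE _|ji ijE /= jl].
  exists (2%:R^-1 *: ((\sum_m c m *: g m) * b) + 0), a; split=> //.
    by apply: ext_spanD; [exact: ext_span_comb|exact: ext_span0 la].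
  rewrite mulrDr addrC addr0; congr (_ + _); rewrite mulrA -iiE -mulr2n.
  by rewrite -scaler_nat -scalerAl scalerA mulVf// scale1r.
exists (1 *: (x j * a) + (\sum_m c m *: g m) * b), ((-1) *: (x j * b) + 0); split.
- by apply: ext_spanD; [exact: IH|exact: ext_span_comb].
- by apply: ext_spanD; [exact: IH|exact: ext_span0 la].
- rewrite scale1r addr0 scaleN1r mulrN -ijE mulrDr mulrDl !mulrA.
  by rewrite addrA addrK.
Qed.

Lemma ext_span_full s : ext_span (index_enum 'I_n) s.
Proof.
have span1 l : ext_span l 1.
  by elim: l => [|i l IH]; [exact: central_span1|exact: ext_spanS].
elim/xg_ind: s => [||a s t|i s|i s]; first exact: ext_span0 (span1 _).
- exact: span1.
- exact: ext_spanD.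
- by apply: ext_span_mulx; rewrite mem_index_enum.
- exact: ext_spanM.
Qed.

(** The parity condition outside [l] leaves room for the next generator: when [i] is prepended,
    [e i] is even, and raising it by 1 inserts the factor [x i]. *)
Lemma ext_span_mon l s : uniq l -> ext_span l s ->
  lspan (fun t : S => exists2 e : {ffun 'I_n -> nat}, (forall i, i \notin l -> ~~ odd (e i)) &
                              t = partial_mon l e) s.
Proof.
elim: l s => [|i l IH] s /=.
  move=> _; elim=> [|c a b _ IHa _ IHb|j a _]; last 1 first.
  - apply: lspan_mul => _ [e he ->]; apply: lspan_sub.
    exists (exp_add e j 2); last by rewrite partial_mon_mulg.
    by move=> i il; rewrite exp_addE oddD mul2n odd_double addbF he.
  - apply: lspan_sub; exists [ffun=> 0%N]; first by move=> i _; rewrite ffunE.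
    rewrite /partial_mon big_nil mul1r big1// => i _.
    by rewrite ffunE expr0.
  - exact: lspan_linear.
move=> /andP[il ul] [a [b [/(IH _ ul) la /(IH _ ul) lb ->]]].
rewrite -[a]scale1r; apply: lspan_linear; last first.
  apply: lspan_mul lb => _ [e he ->]; apply: lspan_sub.
  exists (exp_add e i 1); last by rewrite partial_mon_mulx// he.
  move=> j; rewrite inE negb_or => /andP[/negPf ji jl].
  by rewrite exp_addE ji muln0 addn0 he.
rewrite -[a]mul1r; apply: lspan_mul la => _ [e he ->]; apply: lspan_sub.
exists e => [j|]; first by rewrite inE negb_or => /andP[_ /he].
by rewrite mul1r /partial_mon big_cons (negPf (he i il)) expr0 mul1r.
Qed.

Lemma cliff_mon_span s : lspan (fun t : S => exists e : {ffun 'I_n -> nat}, t = cliff_mon e) s.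
Proof.
rewrite -[s]mul1r.
apply: lspan_mul (ext_span_mon (index_enum_uniq _) (ext_span_full s)) => _ [e _ ->].
by apply: lspan_sub; exists e; rewrite mul1r.
Qed.

(** A linear map from the polynomial ring k[z_1, ..., z_n], seen as the span of the exponents.
    Multiplication by z_j^2 becomes [mon_shift j] below and corresponds to multiplication by
    [g j]. *)
Definition mon_comb : {malg k[{ffun 'I_n -> nat}]} -> S :=
  mmap (in_alg S) cliff_mon.

HB.instance Definition _ := GRing.isZmodMorphism.Build _ _ mon_comb
  (@mmap_is_additive _ _ _ (in_alg S) cliff_mon).

Lemma mon_combE p : mon_comb p = \sum_(e <- msupp p) p@_e *: cliff_mon e.
Proof. by rewrite /mon_comb mmapE; apply: eq_bigr => e _; rewrite mulr_algl. Qed.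

Lemma mon_combU c e : mon_comb << c *g e >> = c *: cliff_mon e.
Proof. by rewrite /mon_comb [LHS]mmapU [LHS]mulr_algl. Qed.

Lemma mon_comb_surj s : exists p, s = mon_comb p.
Proof.
elim: (cliff_mon_span s) => [|c _ b [e ->] _ [p ->]]; first by exists 0; rewrite raddf0.
by exists (<< c *g e >> + p); rewrite raddfD /= mon_combU.
Qed.

Lemma mon_comb_homog d p : cg_gr d (mon_comb p) ->
  mon_comb p = \sum_(e <- exps n d) p@_e *: cliff_mon e.
Proof.
(* [L] contains [d] besides the degrees occurring in [p], so that [mon_comb p] can be subtracted in
   degree [d] from its own decomposition; independence of the homogeneous parts then gives
   [mon_comb p = u d]. *)
move=> hd; have [L uL [dL pL]] : exists2 L : seq nat, uniq L &
    d \in L /\ forall e, e \in msupp p -> exp_deg e \in L.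
  exists (undup (d :: [seq exp_deg e | e <- msupp p])); first exact: undup_uniq.
  by split=> [|e ep]; rewrite mem_undup inE ?eqxx// map_f ?orbT.
pose u i := \sum_(e <- msupp p | exp_deg e == i) p@_e *: cliff_mon e.
have u_gr i : cg_gr i (u i).
  apply: (ds_sum (cg_ds S)) => e /eqP <-; exact/cg_grZ/cliff_mon_gr.
have sum_u : mon_comb p = \sum_(i <- L) u i.
  rewrite mon_combE /u (exchange_big_dep xpredT)//.
  apply: eq_big_seq => e ep; rewrite -big_filter.
  rewrite (_ : [seq i <- _ | _] = [:: exp_deg e]) ?big_seq1//.
  rewrite (eq_filter (a2 := pred1 (exp_deg e))) => [|i]; last exact: eq_sym.
  by rewrite filter_pred1_uniq// pL.
have ud : mon_comb p = u d.
  pose v i := u i - (if i == d then mon_comb p else 0).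
  have v0 : v d = 0.
    apply: (ds_indep (cg_ds S) uL (u := v) _ _ dL).
      move=> i; apply: (ds_sub (cg_ds S)) => //.
      by case: eqP => [->//|_]; exact: (ds_zero (cg_ds S)).
    rewrite sumrB -sum_u -big_mkcond -big_filter.
    rewrite (eq_filter (a2 := pred1 d))// filter_pred1_uniq//.
    by rewrite big_seq1 subrr.
  by apply/eqP; rewrite eq_sym -subr_eq0; move/eqP: v0; rewrite /v eqxx.
rewrite ud /u -big_filter [RHS](bigID (mem (msupp p))) /=.
rewrite [X in _ = _ + X]big1 ?addr0; last first.
  by move=> e /mcoeff_outdom ->; rewrite scale0r.
rewrite -[RHS]big_filter; apply: perm_big; apply: uniq_perm.
- by rewrite filter_uniq// fset_uniq.
- by rewrite filter_uniq// exps_uniq.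
- by move=> e; rewrite !mem_filter mem_exps andbC.
Qed.

Lemma exps_mon_indep d (c : {ffun 'I_n -> nat} -> k) :
  \sum_(e <- exps n d) c e *: cliff_mon e = 0 ->
  forall e, e \in exps n d -> c e = 0.
Proof.
pose e0 : {ffun 'I_n -> nat} := [ffun=> 0%N]; pose N := size (exps n d).
pose v (i : 'I_N) := cliff_mon (nth e0 (exps n d) i).
have vi : lin_indep v.
  apply: (has_dim_lin_indep (hilbert_size_exps d hilb)) => [i|s].
    have : nth e0 (exps n d) i \in exps n d by exact: mem_nth.
    by rewrite mem_exps => /eqP <-; exact: cliff_mon_gr.
  have [p ->] := mon_comb_surj s => /mon_comb_homog ->.
  exists (fun i => p@_(nth e0 (exps n d) i)).
  by rewrite (big_nth e0) big_mkord.
rewrite (big_nth e0) big_mkord => c0 e ed.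
have eN : (index e (exps n d) < N)%N by rewrite index_mem.
by have := vi (fun i => c (nth e0 (exps n d) i)) c0 (Ordinal eN); rewrite nth_index.
Qed.

(** Zero is homogeneous of every degree, so [mon_comb_homog] splits a relation into relations in
    single degrees. *)
Lemma mon_comb_inj : injective mon_comb.
Proof.
apply: raddf_inj => p p0; apply/malgP => e; rewrite mcoeff0.
apply: (@exps_mon_indep (exp_deg e)); last by rewrite mem_exps.
rewrite -mon_comb_homog// p0; exact: (ds_zero (cg_ds S)).
Qed.

Definition mon_shift j (p : {malg k[{ffun 'I_n -> nat}]}) : {malg k[{ffun 'I_n -> nat}]} :=
  \sum_(e <- msupp p) << p@_e *g exp_add e j 2 >>.

Lemma mon_comb_shift j p : mon_comb (mon_shift j p) = g j * mon_comb p.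
Proof.
rewrite raddf_sum mon_combE mulr_sumr; apply: eq_bigr => e _ /=.
by rewrite mon_combU -scalerAr -partial_mon_mulg.
Qed.

Lemma mon_shift_coef j p e' : (mon_shift j p)@_e' != 0 ->
  exists2 e, p@_e != 0 & e' = exp_add e j 2.
Proof.
rewrite raddf_sum /= => h.
have [/hasP[e ep /eqP <-]|/hasPn none] :=
    boolP (has (fun e => exp_add e j 2 == e') (msupp p)).
  by exists e; rewrite // mcoeff_neq0.
case/eqP: h; rewrite big_seq big1// => e /none /negPf ee'.
by rewrite mcoeffU ee' mulr0n.
Qed.

Lemma exp_add_inj j c : injective (fun e => exp_add e j c).
Proof.
by move=> e e' /ffunP ee'; apply/ffunP => i; have := ee' i; rewrite !exp_addE => /addIn.
Qed.

Lemma mon_shift_coef_add j p e : (mon_shift j p)@_(exp_add e j 2) = p@_e.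
Proof.
rewrite raddf_sum /= (eq_bigr (fun e' => if e' == e then p@_e else 0)) => [|e' _].
  rewrite -big_mkcond -big_filter; have [ep|ep] := boolP (e \in msupp p).
    by rewrite (eq_filter (a2 := pred1 e))// filter_pred1_uniq ?fset_uniq// big_seq1.
  rewrite (eq_in_filter (a2 := pred0)) ?filter_pred0 ?big_nil ?(mcoeff_outdom ep)//.
  by move=> e' e'p; apply: contraNF ep => /eqP <-.
rewrite mcoeffU (inj_eq (@exp_add_inj j 2)).
by have [->|_] := eqVneq e' e; rewrite ?mulr1n ?mulr0n.
Qed.

(** * Regularity as a statement about monomials *)

Lemma ideal_gen_central (P : pred 'I_n) s :
  ideal_gen [set g j | j in [set j | P j]]%classic s ->
  exists t : 'I_n -> S, s = \sum_(j | P j) g j * t j.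
Proof.
apply: (@ideal_gen_min _ _
  [set u : S | exists t : 'I_n -> S, u = \sum_(j | P j) g j * t j]%classic).
  split=> /=.
  - by exists (fun=> 0); rewrite big1// => j _; rewrite mulr0.
  - move=> _ _ [t ->] [t' ->]; exists (fun j => t j + t' j).
    by rewrite -big_split; apply: eq_bigr => j _; rewrite mulrDr.
  - move=> a _ [t ->]; exists (fun j => a * t j); rewrite mulr_sumr.
    by apply: eq_bigr => j _; rewrite mulrA [g j * a]gC mulrA.
  - move=> _ a [t ->]; exists (fun j => t j * a); rewrite mulr_suml.
    by apply: eq_bigr => j _; rewrite mulrA.
move=> _ [j /= Pj <-]; exists (fun i => (i == j)%:R).
rewrite (bigD1 j)//= eqxx mulr1 big1 ?addr0// => i /andP[_ /negPf ->].
by rewrite mulr0.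
Qed.

(** Each monomial [e] of [s] appears in [g r * s] raised by 2 at [r], hence in some [g j * t j] with
    [P j], where the exponent at [j] is at least 2. As [j] differs from [r], already [e j] is at
    least 2, so [cliff_mon e] is a multiple of [g j]. *)
Lemma cliff_mon_regular (P : pred 'I_n) r s : ~~ P r ->
  ideal_gen [set g j | j in [set j | P j]]%classic (g r * s) ->
  ideal_gen [set g j | j in [set j | P j]]%classic s.
Proof.
move=> Pr /ideal_gen_central[t tE]; have [p pE] := mon_comb_surj s.
have /choice[q qE] j : exists q, t j = mon_comb q := mon_comb_surj (t j).
have shE : mon_shift r p = \sum_(j | P j) mon_shift j (q j).
  apply: mon_comb_inj; rewrite mon_comb_shift -pE tE raddf_sum.
  by apply: eq_bigr => j _; rewrite /= mon_comb_shift qE.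
rewrite pE mon_combE.
have [J0 JD JMl JMr] := ideal_genP [set g j | j in [set j | P j]]%classic.
rewrite big_seq; elim/big_ind: _ => // e ep.
have : (mon_shift r p)@_(exp_add e r 2) != 0.
  by rewrite mon_shift_coef_add mcoeff_neq0.
rewrite shE raddf_sum /=.
have [/existsP[j /andP[Pj]]|/existsPn none] :=
    boolP [exists j, P j && ((mon_shift j (q j))@_(exp_add e r 2) != 0)]; last first.
  rewrite big1 ?eqxx// => j Pj; have := none j.
  by rewrite Pj negbK => /eqP.
move=> /mon_shift_coef[e' _ /ffunP/(_ j)] ej _.
have rj : j != r by apply: contraNneq Pr => <-.
rewrite !exp_addE eqxx (negPf rj) muln0 muln1 addn0 in ej.
have eE : e = exp_add [ffun i => e i - 2 * (i == j)]%N j 2.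
  apply/ffunP => i; rewrite exp_addE ffunE subnK//.
  by have [->|_] := eqVneq i j; rewrite ?muln0// muln1 ej leq_addl.
rewrite eE /cliff_mon partial_mon_mulg scalerAr; apply: JMr; apply: sub_ideal_gen.
by exists j.
Qed.

(** The [g j] are themselves monomials of the basis. Applied to the generators [y], this is an input
    to the description of the central elements of degree 2. *)
Lemma cliff_mon_lin_indep : lin_indep g.
Proof.
move=> c c0 j; pose a i : {ffun 'I_n -> nat} := exp_add [ffun=> 0%N] i 2.
have monE i : cliff_mon (a i) = g i.
  rewrite /cliff_mon partial_mon_mulg /partial_mon big1 => [|l _].
    by rewrite mul1r big1 ?mulr1// => l _; rewrite ffunE expr0.
  by rewrite ffunE expr0.
have : \sum_i << c i *g a i >> = 0 :> {malg k[{ffun 'I_n -> nat}]}.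
  apply: mon_comb_inj; rewrite raddf0 raddf_sum -[RHS]c0.
  by apply: eq_bigr => i _; rewrite /= mon_combU monE.
move=> /(congr1 (mcoeff (a j))); rewrite mcoeff0 raddf_sum (bigD1 j)//= mcoeffUU.
rewrite big1 ?addr0// => i ij; rewrite mcoeffU.
case: eqP => [/ffunP/(_ i)|_]; last by rewrite mulr0n.
by rewrite !exp_addE !ffunE eqxx (negPf ij).
Qed.

End MonomialBasis.

Lemma extend_to_basis (k : fieldType) (n r : nat) (u : 'I_r -> 'rV[k]_n) :
  lin_indep u -> (r <= n)%N /\ exists (w : 'I_n -> 'rV[k]_n) (C : 'M[k]_n),
    (forall (i : 'I_r) (j : 'I_n), i = j :> nat -> w j = u i) /\
    forall m, delta_mx 0 m = \sum_j C m j *: w j.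
Proof.
move=> ui; pose X := [tuple u i | i < r].
have XE (i : 'I_r) : X`_i = u i by rewrite -(tnth_nth 0 X) tnth_mktuple.
have freeX : free X.
  apply/freeP => c c0; apply: ui; rewrite -[RHS]c0; apply: eq_bigr => i _.
  by rewrite XE.
pose Y := X ++ vbasis (<<X>>^C)%VS.
have basisY : basis_of fullv Y.
  rewrite -(addv_complf <<X>>%VS); apply: cat_basis.
  - by apply/directv_addP; exact: capv_compl.
  - by rewrite /basis_of eqxx.
  - exact: vbasisP.
have sizeY : size Y == n.
  by rewrite -(size_basis (X := in_tuple Y) basisY) dimvf; apply/eqP; exact: mul1n.
have rn : (r <= n)%N by rewrite -(eqP sizeY) size_cat size_tuple leq_addr.
split=> //; pose Z := Tuple sizeY.
exists (fun j => Z`_j), (\matrix_(m, j) coord Z j (delta_mx 0 m)); split=> [i j ij|m].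
  by rewrite /= nth_cat size_tuple -ij ltn_ord XE.
rewrite [LHS](coord_basis (X := Z) basisY) ?memvf//.
by apply: eq_bigr => j _; rewrite mxE.
Qed.

(** * Central elements of degree 2 *)

Section CliffordQuantumPolynomial.
Context (k : fieldType) (n : nat) (S : cgAlg k) (F : 'I_n -> 'M[k]_n).
Context (phi : {lrmorphism clifford_free k n -> S}).
Hypothesis phi_ker : forall p, phi p = 0 <-> ideal_gen (clifford_rel F) p.
Hypothesis phi_gr :
  forall d, (phi @` free_gr (@clifford_wt n) d = @cg_gr k S d)%classic.
Hypothesis two_neq0 : 2%:R != 0 :> k.
Hypothesis S_qp : quantum_polynomial n S.

Let x (i : 'I_n) : S := phi (clifford_x k i).
Let y (i : 'I_n) : S := phi (clifford_y k i).

Let yspan (w : 'rV[k]_n) : S := \sum_m w 0 m *: y m.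

Let yspan_linear : linear yspan.
Proof.
move=> c u v; rewrite /yspan scaler_sumr -big_split; apply: eq_bigr => m _.
by rewrite !mxE scalerDl scalerA.
Qed.

HB.instance Definition _ :=
  GRing.isLinear.Build k 'rV[k]_n S *:%R yspan yspan_linear.

Let yspan_delta m : yspan (delta_mx 0 m) = y m.
Proof.
rewrite /yspan (bigD1 m)//= !mxE !eqxx scale1r big1 ?addr0// => j /negPf jm.
by rewrite mxE jm andbF scale0r.
Qed.

Let yspan_central w : center (yspan w).
Proof.
move=> s; rewrite /GRing.comm mulr_suml mulr_sumr; apply: eq_bigr => m _.
by rewrite -scalerAl -scalerAr (clifford_y_central phi_ker phi_gr).
Qed.

(** The monomial basis for [g = y] gives independence of the [y m], and finite global dimension
    excludes a common null vector of the [F m]; these are the two hypotheses of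
    [clifford_central_deg2]. *)
Lemma clifford_Z2_yspan (r : nat) (g : 'I_r -> S) : in_Z2 g ->
  exists u : 'I_r -> 'rV[k]_n, forall i, g i = yspan (u i).
Proof.
have [_ [gl _] _ hilb] := S_qp.
have yi : lin_indep y.
  apply: (@cliff_mon_lin_indep k n S x y) => //.
  - exact: clifford_x_gr phi_gr.
  - exact: clifford_y_gr phi_gr.
  - exact: clifford_y_central phi_ker phi_gr.
  - move=> i j; exists (fun m => F m i j); exact: clifford_x_anticomm phi_ker _ _.
  - exact: clifford_ind phi_gr.
move=> hg; have nondeg := clifford_nondegenerate phi_ker phi_gr two_neq0 gl.
have /choice[a aE] i : exists a : 'I_n -> k, g i = \sum_m a m *: y m.
  have [gC g2] := hg i.
  exact: (clifford_central_deg2 phi_ker phi_gr two_neq0 nondeg yi gC g2).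
exists (fun i => \row_m a i m) => i; rewrite aE.
by apply: eq_bigr => m _; rewrite mxE.
Qed.

Lemma clifford_Z2_extend (r : nat) (g : 'I_r -> S) : in_Z2 g -> lin_indep g ->
  (r <= n)%N /\ exists (w : 'I_n -> 'rV[k]_n) (C : 'M[k]_n),
    (forall (i : 'I_r) (j : 'I_n), i = j :> nat -> yspan (w j) = g i) /\
    forall m, y m = \sum_j C m j *: yspan (w j).
Proof.
move=> hg gi; have [u uE] := clifford_Z2_yspan hg.
have ui : lin_indep u.
  move=> c c0; apply: gi; under eq_bigr => i _ do rewrite uE -linearZ.
  by rewrite -linear_sum c0 linear0.
have [rn [w [C [wu CE]]]] := extend_to_basis ui.
split=> //; exists w, C; split=> [i j ij|m]; first by rewrite uE (wu i).
rewrite -yspan_delta CE linear_sum; apply: eq_bigr => j _.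
by rewrite linearZ.
Qed.

(** The first [i] terms of [g] and of the extended basis [g'] generate the same ideal, so
    [cliff_mon_regular] applies to the monomials built from [g'], with the predicate [j < i]. *)
Lemma clifford_Z2_regular (r : nat) (g : 'I_r -> S) (hg : in_Z2 g) :
  lin_indep g -> regular_sequence hg.
Proof.
move=> gi; have [rn [w [C [wg yC]]]] := clifford_Z2_extend hg gi.
have [_ _ _ hilb] := S_qp.
pose g' j := yspan (w j).
(* Each [y i] is a combination of the [g' j], so induction along the [x] and [g'] follows from
   induction along the [x] and [y]. *)
have sum_g' i s (P : S -> Prop) : P 0 ->
    (forall a s t, P s -> P t -> P (a *: s + t)) ->
    (forall j s, P s -> P (g' j * s)) -> P s -> P (y i * s).
  move=> P0 PD Pg Ps; rewrite yC mulr_suml.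
  elim: (index_enum _) => [|j l IH]; first by rewrite big_nil.
  by rewrite big_cons -scalerAl; apply: PD => //; exact: Pg.
have regular := @cliff_mon_regular k n S x g' two_neq0.
move=> i /=; set J := seq_ideal hg i; set gi' := quot_pi J (g i).
have JP s : ideal_set J s <-> ideal_gen [set g' j | j in [set j : 'I_n | (j < i)%N]]%classic s.
  rewrite /= (_ : [set g' j | j in _]%classic =
    [set g j | j in [set j : 'I_r | (j < i)%N]]%classic)//.
  apply/seteqP; split=> _ [j /= ji <-].
    by exists (Ordinal (ltn_trans ji (ltn_ord i))) => //; exact/esym/wg.
  by exists (widen_ord rn j) => //; exact: wg.
have JK s : ideal_set J (g i * s) -> ideal_set J s.
  rewrite !JP -(wg i (widen_ord rn i))//.
  apply: regular => //.
  - exact: clifford_x_gr phi_gr.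
  - move=> j; apply: (ds_sum (cg_ds S)) => m _; apply: cg_grZ.
    exact: clifford_y_gr phi_gr _.
  - by move=> j; exact: yspan_central.
  - move=> i' j; exists (fun l => \sum_m F m i' j * C m l).
    rewrite (clifford_x_anticomm phi_ker).
    under eq_bigr => m _ do rewrite -/(y m) yC scaler_sumr.
    rewrite exchange_big; apply: eq_bigr => l _; rewrite scaler_suml.
    by apply: eq_bigr => m _; rewrite scalerA.
  - move=> P P0 P1 PD Px Pg; apply: (clifford_ind phi_gr) => // j t.
    exact: sum_g'.
  - by rewrite ltnn.
have lreg : GRing.lreg gi'.
  elim/quot_ind=> a; elim/quot_ind=> b /eqP.
  rewrite -subr_eq0 -mulrBr -[_ - _](rmorphB (quot_pi J)) -rmorphM.
  move=> /eqP/quot_pi_eq0/JK/(quot_pi_eq0 J) /eqP.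
  by rewrite rmorphB subr_eq0 => /eqP.
split=> // a b ab; apply: lreg.
have gC c : gi' * c = c * gi'.
  elim/quot_ind: c => c; have [gC _] := hg i.
  by rewrite -[LHS](rmorphM (quot_pi J)) gC [LHS]rmorphM.
by rewrite !gC.
Qed.

(** * The exterior quotient *)

(** Modulo the [y m] the [x i] anticommute, and as 2 is invertible this amounts to all their linear
    combinations having square zero. Each algebra thus satisfies the relations of the other, and the
    resulting morphisms are mutually inverse on generators. *)
Lemma clifford_exterior_iso (Q L : algType k) (pi : {lrmorphism S -> Q})
    (pe : {lrmorphism free_alg k 'I_n -> L}) :
  (forall q, exists s, pi s = q) -> (forall l, exists p, pe p = l) ->
  (forall s, pi s = 0 <-> ideal_gen (range y) s) ->
  (forall p, pe p = 0 <-> ideal_gen (@exterior_rel k n) p) ->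
  exists r : {lrmorphism Q -> L}, bijective r /\ forall d,
    (r @` (pi @` @cg_gr k S d) = pe @` free_gr (fun=> 1%N) d)%classic.
Proof.
move=> pi_surj pe_surj pi0 pe0.
have pi_y m : pi (y m) = 0 by apply/pi0; apply: sub_ideal_gen; exists m.
have pi_anti i j : pi (x i) * pi (x j) + pi (x j) * pi (x i) = 0.
  transitivity (pi (x i * x j + x j * x i)); first by rewrite rmorphD !rmorphM.
  rewrite (clifford_x_anticomm phi_ker).
  by rewrite raddf_sum big1// => m _; rewrite /= linearZ /= [Z in _ *: Z]pi_y scaler0.
have sqr0 (c : 'I_n -> k) :
    pe (\sum_i c i *: free_gen k i) * pe (\sum_i c i *: free_gen k i) = 0.
  rewrite -rmorphM; apply/pe0; apply: sub_ideal_gen.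
  by exists (\sum_i c i *: free_gen k i) => //; exists c.
have pe_anti i j :
    pe (free_gen k i) * pe (free_gen k j) + pe (free_gen k j) * pe (free_gen k i) = 0.
  have gE l : free_gen k l = \sum_i (i == l)%:R *: free_gen k i :> free_alg k 'I_n.
    rewrite (bigD1 l)//= eqxx scale1r big1 ?addr0// => m /negPf ->.
    by rewrite scale0r.
  have gg l : pe (free_gen k l) * pe (free_gen k l) = 0 by rewrite gE sqr0.
  apply: sqr0_anticomm => //; rewrite -rmorphD.
  have -> : free_gen k i + free_gen k j =
      \sum_l ((l == i)%:R + (l == j)%:R) *: free_gen k l :> free_alg k 'I_n.
    rewrite [in LHS](gE i) [in LHS](gE j) -big_split.
    by apply: eq_bigr => l _; rewrite scalerDl.
  exact: sqr0.
pose h (v : 'I_n + 'I_n) := if v is inl i then pe (free_gen k i) else 0.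
have [theta theta_gen] := free_universal h.
have theta_x i : theta (clifford_x k i) = pe (free_gen k i) := theta_gen (inl i).
have theta_y i : theta (clifford_y k i) = 0 := theta_gen (inr i).
have [eta eta_x] := free_universal (fun i => pi (x i)).
have [rho rhoE] : exists rho : {lrmorphism S -> L}, forall p, rho (phi p) = theta p.
  apply: lrmorphism_factor (clifford_phi_surj phi_gr) _ => p /phi_ker.
  apply: (@ideal_gen_min _ _ [set q | theta q = 0]%classic); first exact: ker_ideal.
  move=> _ [i [j [] ->]] /=.
  - rewrite rmorph_anticomm /= theta_x (theta_x j) pe_anti raddf_sum big1 ?subrr// => m _.
    by rewrite /= linearZ /= theta_y scaler0.
  - by rewrite rmorph_commutator /= theta_y mulr0 mul0r subrr.
  - by rewrite rmorph_commutator /= theta_y !mul0r mulr0 subrr.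
have rho_y m : rho (y m) = 0 by rewrite rhoE theta_y.
have [r rE] : exists r : {lrmorphism Q -> L}, forall s, r (pi s) = rho s.
  apply: lrmorphism_factor pi_surj _ => s /pi0.
  apply: (@ideal_gen_min _ _ [set q | rho q = 0]%classic); first exact: ker_ideal.
  by move=> _ [j _ <-]; exact: rho_y.
have [r' r'E] : exists r' : {lrmorphism L -> Q}, forall p, r' (pe p) = eta p.
  apply: lrmorphism_factor pe_surj _ => s /pe0.
  apply: (@ideal_gen_min _ _ [set q | eta q = 0]%classic); first exact: ker_ideal.
  move=> _ [_ [c _ <-] <-]; rewrite /mkset rmorphM /=.
  have -> : eta (\sum_i c i *: free_gen k i) = \sum_i c i *: pi (x i).
    by rewrite raddf_sum; apply: eq_bigr => i _; rewrite /= linearZ /= eta_x.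
  set X := \sum_i _; have -> : X * X = 2%:R^-1 *: (X * X + X * X).
    by rewrite -mulr2n -scaler_nat scalerA mulVf// scale1r.
  have XX : X * X = \sum_i \sum_j (c i * c j) *: (pi (x i) * pi (x j)).
    rewrite mulr_suml; apply: eq_bigr => i _; rewrite mulr_sumr; apply: eq_bigr => j _.
    by rewrite -scalerAl -scalerAr scalerA.
  rewrite {1}XX XX [X in _ + X]exchange_big -big_split big1 ?scaler0//= => i _.
  rewrite -big_split big1//= => j _.
  by rewrite [c j * _]mulrC -scalerDr pi_anti scaler0.
have pe_gr_linear d c a b : (pe @` free_gr (fun=> 1%N) d)%classic a ->
    (pe @` free_gr (fun=> 1%N) d)%classic b ->
    (pe @` free_gr (fun=> 1%N) d)%classic (c *: a + b).
  move=> [p hp <-] [q hq <-]; exists (c *: p + q); last by rewrite linearP.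
  move=> u; rewrite mcoeffD mcoeffZ; have [/eqP q0|/hq//] := boolP (q@_u == 0).
  by rewrite q0 addr0 mulf_eq0 negb_or => /andP[_ /hp].
have r'rK : cancel r r'.
  move=> q; have [s <-] := pi_surj q.
  have [p <-] := clifford_phi_surj phi_gr s; rewrite rE rhoE.
  apply: (free_ext (e := r' \o theta) (e' := pi \o phi)) => [a|[i|i]] /=.
  - by rewrite !rmorph_alg.
  - by rewrite theta_gen /= r'E eta_x.
  - rewrite theta_gen rmorph0; by rewrite -/(y i) pi_y.
have rr'K : cancel r' r.
  move=> q; have [p <-] := pe_surj q.
  rewrite r'E; apply: (free_ext (e := r \o eta) (e' := pe)) => [a|i] /=.
  - by rewrite !rmorph_alg.
  - by rewrite eta_x rE rhoE theta_x.
exists r; split; first by exists r'.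
move=> d; apply/seteqP; split=> [_ [_ [s sd <-] <-]|_ [p pd <-]].
  rewrite rE; have [p pd <-] : (phi @` free_gr (@clifford_wt n) d)%classic s.
    by rewrite phi_gr.
  rewrite rhoE; elim/free_gr_ind: pd => {p} [|c p q hp hq|l <-].
  - by exists 0; rewrite ?rmorph0// => v; rewrite mcoeff0 eqxx.
  - by rewrite linearP; exact: pe_gr_linear.
  (* A word with a factor [y] is sent to 0; a word in the [x i] alone is sent to the exterior word
     of the same length, which is its weight. *)
  have [->|[t [<- ->]]] : theta (\prod_(i <- l) free_gen k i) = 0 \/
      exists t : seq 'I_n, size t = (\sum_(i <- l) clifford_wt i)%N /\
        theta (\prod_(i <- l) free_gen k i) = pe (\prod_(i <- t) free_gen k i).
    elim: l => [|[i|i] l IH].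
    - by right; exists [::]; rewrite !big_nil !rmorph1.
    - rewrite !big_cons rmorphM /= theta_gen; case: IH => [->|[t [tl ->]]].
        by left; rewrite mulr0.
      by right; exists (i :: t); rewrite big_cons rmorphM /= tl.
    - by left; rewrite big_cons rmorphM /= theta_gen mul0r.
  - by exists 0; rewrite ?rmorph0// => v; rewrite mcoeff0 eqxx.
  exists (\prod_(i <- t) free_gen k i); last by [].
  by have := @free_gr_prod k _ (fun=> 1%N) t; rewrite sum1_size.
exists (r' (pe p)); last exact: rr'K.
rewrite r'E; elim/free_gr_ind: pd => {p} [|c p q [s sd ps] [s' sd' qs']|l <-].
- by exists 0; [exact: (ds_zero (cg_ds S))|rewrite !rmorph0].
- exists (c *: s + s'); last by rewrite !linearP /= ps qs'.
  by apply: (ds_add (cg_ds S)) => //; exact: cg_grZ.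
exists (\prod_(i <- l) x i).
  by apply: cg_gr_prod => i; exact: clifford_x_gr phi_gr _.
by rewrite !rmorph_prod; apply: eq_bigr => i _; rewrite /= eta_x.
Qed.

(** For [r = n] the extended basis is [g] itself, so [C] writes each [y m] through [g], and the
    ideals generated by [g] and by [y] coincide. *)
Lemma clifford_Z2_exterior (g : 'I_n -> S) (hg : in_Z2 g) :
  lin_indep g -> graded_iso (seq_quot_gr hg n) (exterior_gr k n).
Proof.
move=> gi; have [u gu] := clifford_Z2_yspan hg.
have [_ [w [C [wg yC]]]] := clifford_Z2_extend hg gi.
have [pi [piE pi_surj pi0]] := quot_lrmorphism (seq_ideal hg n).
have [pe [peE pe_surj pe0]] := quot_lrmorphism (exterior_ideal k n).
have J2 (X : set S) (a : 'I_n -> k) (b : 'I_n -> S) :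
    (forall m, ideal_gen X (b m)) -> ideal_gen X (\sum_m a m *: b m).
  have [J0 JD JMl _] := ideal_genP X; move=> Xb.
  elim/big_ind: _ => // m _; rewrite -mulr_algl; apply: JMl; exact: Xb.
have [|r [r_bij r_gr]] := clifford_exterior_iso pi_surj pe_surj _ pe0.
  move=> s; rewrite pi0; split; apply: ideal_gen_min; try exact: ideal_genP.
    by move=> _ [j _ <-]; rewrite gu; apply: J2 => m; apply: sub_ideal_gen; exists m.
  move=> _ [m _ <-]; rewrite yC; apply: J2 => j; apply: sub_ideal_gen.
  by exists j; [exact: ltn_ord|rewrite (wg j j)].
exists r; split=> // d; move: (r_gr d).
have -> : (pi : S -> seq_quot hg n) = quot_pi (seq_ideal hg n) by exact/funext.
by have -> : (pe : free_alg k 'I_n -> exterior_alg k n) =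
  quot_pi (exterior_ideal k n) by exact/funext.
Qed.

End CliffordQuantumPolynomial.

Theorem proposition3p23 (k : closedFieldType) (k_char0 : [pchar k] =i pred0)
    (n : nat) (S : cgAlg k) (S_clifford : clifford_quantum_polynomial n S) :
  (forall (r : nat) (g : 'I_r -> S) (hg : in_Z2 g), lin_indep g ->
     regular_sequence hg /\ clifford_qci n r (seq_quot_gr hg r)) /\
  (forall (g : 'I_n -> S) (hg : in_Z2 g), lin_indep g ->
     graded_iso (seq_quot_gr hg n) (exterior_gr k n)).
Proof.
have two_neq0 : 2%:R != 0 :> k by rewrite ((pcharf0P k).1 k_char0).
have [S_qp [F [_ _ /clifford_presentation[phi [phi_ker phi_gr]]]]] := S_clifford.
have regular := clifford_Z2_regular phi_ker phi_gr two_neq0 S_qp.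
split=> [r g hg gi|g hg gi]; last exact: clifford_Z2_exterior phi_ker phi_gr two_neq0 S_qp g hg gi.
split; first exact: regular.
exists S, g, hg; split=> //; first exact: regular.
exists idfun; split; first by exists idfun.
by move=> d; exact: image_id.
Qed.
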